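(* Let $W$ be a finite Coxeter group with standard Coxeter element $c$. Let $\mathcal{P}(W,c)=\mathcal{A}^!$ be the quadratic dual of the dual braid monoid algebra, with generators $x_t$ ($t\in T$), and $\mathcal{P}'(W,c)=\mathcal{N}/J_c$. There is a well-defined algebra isomorphism $\Psi:\mathcal{P}(W,c)\to\mathcal{P}'(W,c)$ such that $\Psi(x_{t_1}\cdots x_{t_j})=t_1\star\cdots\star t_j$ for all $t_1,\dots,t_j\in T$.
   Context: $T$ is the set of reflections; $t^u=u^{-1}tu$; $\ell_T$ is reflection length, $w\le_T z$ iff $\ell_T(w)+\ell_T(w^{-1}z)=\ell_T(z)$; $NC_j(W,c)$ the elements of $[e,c]$ of length $j$. $\mathbf{D}(W)$ has generators $\mathbf{t}$ ($t\in T$) and relations $\mathbf{t}\mathbf{u}=\mathbf{u}\mathbf{t}^{\mathbf{u}}$ whenever $tu\le_T c$ ($\mathbf{t}^{\mathbf{u}}\leftrightarrow utu$); $\mathcal{A}=k[\mathbf{D}(W)]=\mathcal{T}(k^{\mathbf{T}})/\langle R\rangle$ and $\mathcal{A}^!=\mathcal{T}((k^{\mathbf{T}})^* )/\langle R^\perp\rangle$, $(x_t)$ the dual basis. Twisted shuffle on $\mathcal{T}(k^T)$: $(t_1\otimes\cdots\otimes t_i)\star(u_1\otimes\cdots\otimes u_j)=t_1\otimes((t_2\otimes\cdots\otimes t_i)\star(u_1\otimes\cdots\otimes u_j))+(-1)^iu_1\otimes((t_1^{u_1}\otimes\cdots\otimes t_i^{u_1})\star(u_2\otimes\cdots\otimes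 u_j))$, unit the empty tensor. $\mathcal{N}$ is the $\star$-subalgebra generated by $T$, $\mathcal{N}_{(w,j)}=\operatorname{Span}\{t_1\star\cdots\star t_j: t_1\cdots t_j=w\}$, and $J_c=\bigoplus_{w\notin NC_j(W,c)}\mathcal{N}_{(w,j)}$, an ideal. *)

(* Defs.v *)
From HB Require Import structures.
From mathcomp Require Import all_boot all_order all_algebra all_fingroup.
From mathcomp Require Import generic_quotient ring_quotient finmap boolp.
From mathcomp Require Import monalg.
From mathcomp Require Import zify.

Set Implicit Arguments.
Unset Strict Implicit.
Unset Printing Implicit Defensive.

Import GRing.Theory.
Local Open Scope ring_scope.
Local Open Scope quotient_scope.

Inductive lspan (k : fieldType) (V : lmodType k) (G : V -> Prop) : V -> Prop :=
  | lspan0 : lspan G 0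
  | lspan_cons a g x : G g -> lspan G x -> lspan G (a *: g + x).

Inductive ideal_gen (A : nzRingType) (G : A -> Prop) : A -> Prop :=
  | ideal_gen0 : ideal_gen G 0
  | ideal_gen_cons a b g x : G g -> ideal_gen G x -> ideal_gen G (a * g * b + x).

Inductive subalg_gen (k : fieldType) (A : lalgType k) (G : A -> Prop) :
    A -> Prop :=
  | subalg_gen_in g : G g -> subalg_gen G g
  | subalg_gen1 : subalg_gen G 1
  | subalg_genD a x y :
      subalg_gen G x -> subalg_gen G y -> subalg_gen G (a *: x + y)
  | subalg_genM x y : subalg_gen G x -> subalg_gen G y -> subalg_gen G (x * y).

(* The library's idealr only asks for stability under left multiplication.    *)
HB.mixin Record isRightStable (R : nzRingType) (S : R -> bool) := {
  tsidealMl : forall a u, u \in S -> u * a \in S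
}.

#[short(type="tsideal")]
HB.structure Definition TSIdeal (R : nzRingType) :=
  {S of Idealr R S & isRightStable R S}.

Definition tsquot (R : nzRingType) (I : tsideal R) : Type := {ideal_quot I}.
HB.instance Definition _ (R : nzRingType) (I : tsideal R) :=
  GRing.Zmodule.on (tsquot I).

Section TSQuotRing.
Variables (R : nzRingType) (I : tsideal R).
Notation Q := (tsquot I).

Definition tspi (x : R) : tsquot I := \pi_{ideal_quot I} x.
Definition tsrepr (x : tsquot I) : R := repr (x : {ideal_quot I}).

Lemma tsreprK : cancel tsrepr tspi.
Proof. exact: reprK. Qed.

Lemma tspi_eqP x y : reflect (tspi x = tspi y) (x - y \in I).
Proof. rewrite Quotient.idealrBE; exact: eqP. Qed.

Lemma tspi_zmod : zmod_morphism tspi.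
Proof. by move=> x y; rewrite /tspi raddfB. Qed.

HB.instance Definition _ := GRing.isZmodMorphism.Build R Q tspi tspi_zmod.

Let mulq (x y : Q) : Q := tspi (tsrepr x * tsrepr y).

Let pi_mulq : {morph tspi : x y / x * y >-> mulq x y}.
Proof.
move=> x y; rewrite /mulq; apply/tspi_eqP.
have h z : z - tsrepr (tspi z) \in I by apply/tspi_eqP; rewrite tsreprK.
rewrite -[x * y](subrK (x * tsrepr (tspi y))) -mulrBr -addrA -mulrBl.
apply: rpredD; [exact: idealMr | exact: tsidealMl].
Qed.

Let mulqA : associative mulq.
Proof.
move=> x y z; rewrite -[x]tsreprK -[y]tsreprK -[z]tsreprK.
by rewrite -!pi_mulq mulrA.
Qed.

Let mul1q : left_id (tspi 1) mulq.
Proof. by move=> x; rewrite -[x]tsreprK -pi_mulq mul1r. Qed.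

Let mulq1 : right_id (tspi 1) mulq.
Proof. by move=> x; rewrite -[x]tsreprK -pi_mulq mulr1. Qed.

Let mulqDl : left_distributive mulq +%R.
Proof.
move=> x y z; rewrite -[x]tsreprK -[y]tsreprK -[z]tsreprK.
by rewrite -raddfD -!pi_mulq -raddfD mulrDl.
Qed.

Let mulqDr : right_distributive mulq +%R.
Proof.
move=> x y z; rewrite -[x]tsreprK -[y]tsreprK -[z]tsreprK.
by rewrite -raddfD -!pi_mulq -raddfD mulrDr.
Qed.

Let oneq_neq0 : tspi 1 != 0.
Proof.
by apply/eqP; rewrite -(raddf0 tspi) => /tspi_eqP; rewrite subr0 idealr1.
Qed.

HB.instance Definition _ := GRing.Zmodule_isNzRing.Build Q
  mulqA mul1q mulq1 mulqDl mulqDr oneq_neq0.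

Lemma tspi_monoid : monoid_morphism tspi.
Proof. by split => // x y; rewrite pi_mulq. Qed.

HB.instance Definition _ := GRing.isMonoidMorphism.Build R Q tspi tspi_monoid.

End TSQuotRing.
Arguments tspi {R} I x.

Section TSQuotAlg.
Variables (k : fieldType) (A : lalgType k) (I : tsideal A).
Notation Q := (tsquot I).

Let scaleq (a : k) (x : Q) : Q := tspi I a%:A * x.

Let scaleqA a b x : scaleq a (scaleq b x) = scaleq (a * b) x.
Proof. by rewrite /scaleq mulrA -rmorphM -scalerAl mul1r scalerA. Qed.

Let scale1q : left_id 1 scaleq.
Proof. by move=> x; rewrite /scaleq scale1r rmorph1 mul1r. Qed.

Let scaleqDr : right_distributive scaleq +%R.
Proof. by move=> a x y; rewrite /scaleq mulrDr. Qed.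

Let scaleqDl x : {morph scaleq^~ x : a b / a + b}.
Proof. by move=> a b; rewrite /scaleq scalerDl rmorphD mulrDl. Qed.

HB.instance Definition _ := GRing.Zmodule_isLmodule.Build k Q
  scaleqA scale1q scaleqDr scaleqDl.

Let scaleqAl (a : k) (x y : Q) : a *: (x * y) = (a *: x) * y.
Proof. exact: mulrA. Qed.

HB.instance Definition _ := GRing.Lmodule_isLalgebra.Build k Q scaleqAl.

Lemma tspi_scalable : scalable (tspi I).
Proof.
by move=> a x; rewrite -[x in LHS]mul1r scalerAl rmorphM.
Qed.

HB.instance Definition _ := GRing.isScalable.Build k A Q *:%R (tspi I)
  tspi_scalable.
End TSQuotAlg.

(* T(k^X) with its basis of words: << FMonom [:: x1; ..; xn] >> stands for    *)
(* x1 (x) ... (x) xn, and the product is concatenation.                       *)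
Notation tensor k X := {malg k[{fmonom X}]}.

Section Words.
Variables (k : fieldType) (X : choiceType).

Definition word (s : seq X) : tensor k X := << FMonom s >>.

Lemma word_nil : word [::] = 1.
Proof. by rewrite /word -fmoneE. Qed.

Lemma wordM s1 s2 : word s1 * word s2 = word (s1 ++ s2).
Proof. by rewrite /word malgM_def fgmulUU mulr1 /mmul /= fmmulE. Qed.

Section Lext.
Variable V : lmodType k.

Definition lext (h : seq X -> V) (x : tensor k X) : V :=
  \sum_(m <- msupp x) x@_m *: h m.

Lemma lextEw h (d : {fset {fmonom X}}) x : (msupp x `<=` d)%fset ->
  lext h x = \sum_(m <- d) x@_m *: h m.
Proof.
move=> le; rewrite [LHS](big_fset_incl _ le) => //= m _ /mcoeff_outdom ->.
by rewrite scale0r.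
Qed.

Lemma lext_is_linear h : linear (lext h).
Proof.
move=> a x y; pose d := (msupp (a *: x + y) `|` (msupp x `|` msupp y))%fset.
rewrite !(@lextEw h d); last 3 first.
- by apply/fsubsetP => z; rewrite /d !in_fsetE => ->; rewrite ?orbT.
- by apply/fsubsetP => z; rewrite /d !in_fsetE => ->; rewrite ?orbT.
- by apply/fsubsetP => z; rewrite /d !in_fsetE => ->; rewrite ?orbT.
rewrite scaler_sumr -big_split /=; apply: eq_bigr => m _.
by rewrite mcoeffD mcoeffZ scalerDl scalerA.
Qed.

HB.instance Definition _ h :=
  GRing.isLinear.Build k (tensor k X) V *:%R (lext h) (lext_is_linear h).

Lemma lext_word h s : lext h (word s) = h s.
Proof.
rewrite /lext /word msuppU oner_eq0 big_seq_fset1 mcoeffUU scale1r //.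
Qed.

Lemma wordE (x : tensor k X) : x = \sum_(m <- msupp x) x@_m *: word m.
Proof.
rewrite [LHS]monalgE; apply: eq_bigr => m _.
by apply/malgP => m'; rewrite mcoeffZ !mcoeffU fmK mulr_natr.
Qed.

Lemma lin_word_ext (f g : {linear tensor k X -> V}) :
  (forall s, f (word s) = g (word s)) -> f =1 g.
Proof.
move=> fg x; rewrite [x]wordE !linear_sum; apply: eq_bigr => m _.
by rewrite !linearZ /= fg.
Qed.

End Lext.
End Words.
Arguments word {k X} s.

Section Quadratic.
Variables (k : fieldType) (X : finType).

Notation V2 := {ffun X * X -> k^o}.

Definition quad_elt (r : V2) : tensor k X :=
  \sum_p r p *: word [:: p.1; p.2].

Definition quad_ideal (R : V2 -> Prop) (x : tensor k X) : bool :=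
  `[< ideal_gen (fun y => exists2 r, R r & y = quad_elt r) x >].

Variable R : V2 -> Prop.
Notation I := (quad_ideal R).

Let quad_addD x y : x \in I -> y \in I -> x + y \in I.
Proof.
move=> /asboolP Ix /asboolP Iy; apply/asboolP.
elim: Ix => [|a b g z Gg _ IH]; first by rewrite add0r.
by rewrite -addrA; apply: ideal_gen_cons.
Qed.

Let quad_mul a b x : x \in I -> a * x * b \in I.
Proof.
move=> /asboolP Ix; apply/asboolP.
elim: Ix => [|a' b' g z Gg _ IH]; first by rewrite mulr0 mul0r; apply: ideal_gen0.
rewrite mulrDr mulrDl !mulrA -[_ * b' * b]mulrA.
exact: ideal_gen_cons.
Qed.

Let quad_idealr : idealr_closed I.
Proof.
split.
- by apply/asboolP; apply: ideal_gen0.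
- apply/negP => /asboolP I1.
  have: (1 : tensor k X)@_(mone : {fmonom X}) = 0.
    elim: I1 => [|a b g z [r _ ->] _ IH]; first exact: mcoeff0.
    have g0 : (quad_elt r)@_(mone : {fmonom X}) = 0.
      rewrite raddf_sum big1 //= => p _.
      by rewrite mcoeffZ mcoeffU fmP fm1 mulr0.
    by rewrite mcoeffD IH addr0 !rmorphM /= g0 mulr0 mul0r.
  by rewrite mcoeff1 eqxx => /eqP; rewrite oner_eq0.
- by move=> a x y Ix Iy; rewrite -[a * x]mulr1 quad_addD ?quad_mul.
Qed.

HB.instance Definition _ := isIdealr.Build (tensor k X) (quad_ideal R) quad_idealr.

Let quad_right a x : x \in I -> x * a \in I.
Proof. by move=> Ix; rewrite -[x]mul1r quad_mul. Qed.

HB.instance Definition _ :=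
  isRightStable.Build (tensor k X) (quad_ideal R) quad_right.

Definition quad_alg := tsquot (quad_ideal R).
HB.instance Definition _ := GRing.Lalgebra.on quad_alg.

Definition quad_gen (x : X) : quad_alg := tspi (quad_ideal R) (word [:: x]).

End Quadratic.

(* The coordinates of an element of (k^X)^* (x) (k^X)^* are taken in the      *)
(* tensor square of the dual basis, so the sum is the evaluation pairing.     *)
Definition quad_perp (k : fieldType) (X : finType)
    (R : {ffun X * X -> k^o} -> Prop) (f : {ffun X * X -> k^o}) : Prop :=
  forall r, R r -> \sum_p f p * r p = 0.

(* Bourbaki's definition: S consists of involutions and, with m(s,t) the      *)
(* order of st, the group is presented by < S | (st)^m(s,t) = 1 >.            *)
Definition coxeter_system (gT : finGroupType) (S : {set gT}) : Prop :=
  [/\ <<S>>%g = [set: gT], {in S, forall s, #[s]%g = 2} &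
      forall (H : groupType) (f : gT -> H),
        {in S &, forall s t, ((f s * f t) ^+ #[s * t])%g = 1%g} ->
        exists2 phi : gT -> H,
          {morph phi : x y / (x * y)%g} & {in S, phi =1 f}].

Record finCoxeter := FinCoxeter {
  cox_group :> finGroupType;
  simple_refl : {set cox_group};
  finCoxeterP : coxeter_system simple_refl
}.

Section Reflections.
Variable W : finCoxeter.
Implicit Types (w z : W).

Definition reflections : {set W} := class_support (simple_refl W) [set: W].
Record refl : predArgType := Refl { rval : W; _ : rval \in reflections }.
HB.instance Definition _ := [isSub for rval].
HB.instance Definition _ := [Finite of refl by <:].

Lemma reflJ w z : w \in reflections -> (w ^ z)%g \in reflections.
Proof.
case/imset2P => s x Ss _ ->; rewrite -conjgM.
by apply/imset2P; exists s (x * z)%g.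
Qed.

Definition rconjw (t : refl) w : refl := Sub (val t ^ w)%g (reflJ w (valP t)).
Definition rconj (t u : refl) : refl := rconjw t (val u).

Definition rprod (ts : seq refl) : W := (\prod_(t <- ts) val t)%g.

Definition has_factorization w j :=
  [exists ts : j.-tuple refl, rprod ts == w].

Lemma has_factorizationP w j :
  reflect (exists2 ts, size ts = j & rprod ts = w) (has_factorization w j).
Proof.
apply: (iffP existsP) => [[ts /eqP <-]|[ts <- <-]].
  by exists ts; rewrite ?size_tuple.
by exists (in_tuple ts).
Qed.

Lemma rprod_cat s1 s2 : rprod (s1 ++ s2) = (rprod s1 * rprod s2)%g.
Proof. by rewrite /rprod big_cat. Qed.

Lemma ex_factorization w : exists j, has_factorization w j.
Proof.
have [gS _ _] := finCoxeterP W.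
have : w \in <<simple_refl W>>%g by rewrite gS inE.
case/gen_prodgP => n [f Sf ->]; elim: n f Sf => [|n IH] f Sf.
  exists 0; apply/has_factorizationP; exists [::] => //.
  by rewrite /rprod big_nil big_ord0.
rewrite big_ord_recr /=.
have [j /has_factorizationP[ts szts <-]] :=
  IH (fun i => f (widen_ord (leqnSn n) i)) (fun i => Sf _).
have Tf : f ord_max \in reflections.
  by apply/imset2P; exists (f ord_max) 1%g; rewrite ?Sf ?inE ?conjg1.
exists j.+1; apply/has_factorizationP; exists (rcons ts (Sub (f ord_max) Tf)).
  by rewrite size_rcons szts.
by rewrite -cats1 rprod_cat /rprod big_seq1.
Qed.

Definition rlen w : nat := ex_minn (ex_factorization w).

Definition rle w z : bool := (rlen w + rlen (w^-1 * z)%g == rlen z)%N.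

Definition NC (c : W) (j : nat) : {set W} := [set w | rle w c & rlen w == j].

Definition standard_coxeter_elt (c : W) : Prop :=
  exists2 s : seq W, perm_eq s (enum (simple_refl W))
                   & c = (\prod_(x <- s) x)%g.

Lemma rlen_le ts : (rlen (rprod ts) <= size ts)%N.
Proof.
rewrite /rlen; case: ex_minnP => m _; apply.
by apply/has_factorizationP; exists ts.
Qed.

Lemma rlen_factor w : exists2 ts, size ts = rlen w & rprod ts = w.
Proof. by rewrite /rlen; case: ex_minnP => m /has_factorizationP. Qed.

Lemma rlenM w z : (rlen (w * z)%g <= rlen w + rlen z)%N.
Proof.
have [s <- <-] := rlen_factor w; have [t <- <-] := rlen_factor z.
by rewrite -rprod_cat -size_cat rlen_le.
Qed.

Lemma rlenJ w z : (rlen (w ^ z)%g <= rlen w)%N.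
Proof.
have [s <- <-] := rlen_factor w.
have -> : (rprod s ^ z)%g = rprod [seq rconjw t z | t <- s].
  elim: s => [|t s IH]; first by rewrite /rprod !big_nil conj1g.
  by rewrite /rprod /= !big_cons conjMg -/(rprod s) IH.
by rewrite -(size_map (rconjw^~ z)) rlen_le.
Qed.

Lemma rlen1 : rlen 1%g = 0.
Proof.
by apply/eqP; rewrite -leqn0; have := rlen_le [::]; rewrite /rprod big_nil.
Qed.

Lemma NC1 c : 1%g \in NC c 0.
Proof. by rewrite inE /rle rlen1 invg1 mul1g eqxx. Qed.

Lemma NC_factor c s t u :
  rprod (s ++ t ++ u) \in NC c (size (s ++ t ++ u)) ->
  rprod t \in NC c (size t).
Proof.
rewrite !inE /rle !rprod_cat !size_cat.
move: (rprod s) (rprod t) (rprod u) (rlen_le s) (rlen_le t) (rlen_le u).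
move=> a b d la lb ld /andP[/eqP E /eqP L].
have h1 := rlenM a (b * d)%g; have h2 := rlenM b d.
have h3 : (rlen c <= rlen b + rlen (b^-1 * c)%g)%N.
  by rewrite -{1}[c](mulKVg b) rlenM.
have h4 : (rlen (b^-1 * c)%g <=
             rlen d + (rlen ((a * (b * d))^-1 * c)%g + rlen a))%N.
  have -> : (b^-1 * c = d * (((a * (b * d))^-1 * c) * (a ^ c)))%g.
    by rewrite conjgE !invMg !mulgA mulgV mul1g mulgK mulgKV.
  apply: leq_trans (rlenM _ _) _; rewrite leq_add2l.
  by apply: leq_trans (rlenM _ _) _; rewrite leq_add2l rlenJ.
apply/andP; split; lia.
Qed.

End Reflections.

(* The associativity of the twisted shuffle, over an abstract module with a   *)
(* basis w of words: keeping the concrete tensor algebra out of the way makes *)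
(* unification tractable.                                                     *)
Section ShuffleTheory.
Variables (k : fieldType) (T : Type) (cj : T -> T -> T) (A : lmodType k).
Variables (w : seq T -> A) (lx : (seq T -> A) -> {linear A -> A}).
Variables (pre : T -> {linear A -> A}) (sw : seq T -> seq T -> A).
Implicit Types (t u v : T) (ts us : seq T) (x y z : A) (a : k).

Hypothesis cjJ : forall t u v, cj (cj t u) v = cj (cj t v) (cj u v).
Hypothesis w_ind : forall P : A -> Prop,
  P 0 -> (forall a ts x, P x -> P (a *: w ts + x)) -> forall x, P x.
Hypothesis lx_w : forall h s, lx h (w s) = h s.
Hypothesis lxP : forall a f g x,
  lx (fun s => a *: f s + g s) x = a *: lx f x + lx g x.
Hypothesis pre_w : forall t s, pre t (w s) = w (t :: s).
Hypothesis sw_nil : forall us, sw [::] us = w us.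
Hypothesis sw_nilr : forall ts, sw ts [::] = w ts.
Hypothesis sw_cons : forall t ts u us,
  sw (t :: ts) (u :: us) = pre t (sw ts (u :: us))
    + (-1) ^+ size (t :: ts) *: pre u (sw [seq cj s u | s <- t :: ts] us).

Let st x y : A := lx (fun ts => lx (sw ts) y) x.

Let stPl a x y z : st (a *: x + y) z = a *: st x z + st y z.
Proof. by rewrite /st linearP. Qed.

Let stPr a x y z : st x (a *: y + z) = a *: st x y + st x z.
Proof. by rewrite /st -lxP; congr (lx _ x); apply/funext => ts; rewrite linearP. Qed.

Let st0l x : st 0 x = 0.
Proof. by rewrite /st linear0. Qed.

Let st0r x : st x 0 = 0.
Proof.
have /eqP := stPr 1 x 0 0; rewrite !scale1r addr0.
by rewrite -subr_eq0 opprD addrA subrr sub0r oppr_eq0 => /eqP.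
Qed.

Let stDl x y z : st (x + y) z = st x z + st y z.
Proof. by have := stPl 1 x y z; rewrite !scale1r. Qed.

Let stDr x y z : st x (y + z) = st x y + st x z.
Proof. by have := stPr 1 x y z; rewrite !scale1r. Qed.

Let stZl a x y : st (a *: x) y = a *: st x y.
Proof. by have := stPl a x 0 y; rewrite st0l !addr0. Qed.

Let stZr a x y : st x (a *: y) = a *: st x y.
Proof. by have := stPr a x y 0; rewrite st0r !addr0. Qed.

Let stNl x y : st (- x) y = - st x y.
Proof. by rewrite -scaleN1r stZl scaleN1r. Qed.

Let stNr x y : st x (- y) = - st x y.
Proof. by rewrite -scaleN1r stZr scaleN1r. Qed.

Let st_w ts us : st (w ts) (w us) = sw ts us.
Proof. by rewrite /st !lx_w. Qed.

Let st1l x : st (w [::]) x = x.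
Proof.
elim/w_ind: x => [|a ts x IH]; first exact: st0r.
by rewrite stPr IH st_w sw_nil.
Qed.

Let st1r x : st x (w [::]) = x.
Proof.
elim/w_ind: x => [|a ts x IH]; first exact: st0l.
by rewrite stPl IH st_w sw_nilr.
Qed.

Let sig u : {linear A -> A} :=
  lx (fun ts => (-1) ^+ size ts *: w [seq cj s u | s <- ts]).

Let sig_w u ts : sig u (w ts) = (-1) ^+ size ts *: w [seq cj s u | s <- ts].
Proof. exact: lx_w. Qed.

Let sig_nil u : sig u (w [::]) = w [::].
Proof. by rewrite sig_w; exact: scale1r. Qed.
Let sigP u a x y : sig u (a *: x + y) = a *: sig u x + sig u y.
Proof. exact: linearP. Qed.
Let sig0 u : sig u 0 = 0. Proof. exact: linear0. Qed.
Let sigZ u a x : sig u (a *: x) = a *: sig u x. Proof. exact: linearZ. Qed.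
Let sigN u x : sig u (- x) = - sig u x. Proof. exact: linearN. Qed.
Let sigD u x y : sig u (x + y) = sig u x + sig u y. Proof. exact: linearD. Qed.
Let preP u a x y : pre u (a *: x + y) = a *: pre u x + pre u y.
Proof. exact: linearP. Qed.
Let pre0 u : pre u 0 = 0. Proof. exact: linear0. Qed.
Let preZ u a x : pre u (a *: x) = a *: pre u x. Proof. exact: linearZ. Qed.
Let preN u x : pre u (- x) = - pre u x. Proof. exact: linearN. Qed.
Let preD u x y : pre u (x + y) = pre u x + pre u y. Proof. exact: linearD. Qed.

Let sig_pre u t x : sig u (pre t x) = - pre (cj t u) (sig u x).
Proof.
elim/w_ind: x => [|a ts x IH]; first by rewrite pre0 sig0 pre0 oppr0.
rewrite preP !sigP preP IH pre_w !sig_w preZ pre_w /=.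
by rewrite exprS mulN1r scaleNr opprD scalerN.
Qed.

Let sig_sig u v x : sig v (sig u x) = sig (cj u v) (sig v x).
Proof.
elim/w_ind: x => [|a ts x IH]; first by rewrite !sig0.
rewrite !sigP IH !sig_w !sigZ /=; congr (_ *: _ + _).
rewrite !sig_w !size_map -!map_comp; congr (_ *: (_ *: w _)).
by apply: eq_map => t /=; rewrite cjJ.
Qed.

Let st_pre t u x y :
  st (pre t x) (pre u y) =
    pre t (st x (pre u y)) + pre u (st (sig u (pre t x)) y).
Proof.
elim/w_ind: x => [|a ts x IH].
  by rewrite pre0 st0l sig0 !st0l !pre0 addr0.
rewrite preP sigP !stPl !preP IH addrACA -scalerDr.
congr (_ *: _ + _); rewrite pre_w {x IH}.
elim/w_ind: y => [|b us y IH].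
  by rewrite pre0 !st0r !pre0 addr0.
rewrite preP !stPr !preP IH addrACA -scalerDr.
congr (_ *: _ + _); rewrite pre_w.
by rewrite !st_w sig_w stZl preZ st_w sw_cons.
Qed.

Let sig_st v x y : sig v (st x y) = st (sig v x) (sig v y).
Proof.
elim/w_ind: y x => [|b us y IHy] x; first by rewrite sig0 !st0r sig0.
rewrite stPr !sigP stPr IHy; congr (_ *: _ + _) => {y IHy b}.
elim: us x => [|u us IHu] x; first by rewrite st1r sig_nil st1r.
elim/w_ind: x => [|a ts x IHx]; first by rewrite sig0 !st0l sig0.
rewrite stPl !sigP stPl IHx; congr (_ *: _ + _) => {x IHx a}.
elim: ts => [|t ts IHt]; first by rewrite st1l sig_nil st1l.
rewrite -!pre_w in IHt *.
rewrite st_pre sigD [sig v (pre t _)]sig_pre [sig v (pre u (st _ _))]sig_pre.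
rewrite IHt IHu sig_sig !sig_pre !sigN !sig_pre !opprK.
by rewrite !stNl !stNr opprK st_pre sig_pre !stNl !preN !opprK.
Qed.

Lemma shuffleA : associative st.
Proof.
move=> x y z; elim/w_ind: z x y => [|c vs z IHz] x y.
  by rewrite !st0r.
rewrite !stPr IHz; congr (_ *: _ + _) => {z IHz c}.
elim: vs x y => [|v vs IHv] x y; first by rewrite !st1r.
elim/w_ind: y x => [|b us y IHy] x; first by rewrite st0l !st0r st0l.
rewrite stPl !stPr stPl IHy; congr (_ *: _ + _) => {y IHy b}.
elim: us x => [|u us IHu] x; first by rewrite st1l st1r.
elim/w_ind: x => [|a ts x IHx]; first by rewrite !st0l.
rewrite !stPl IHx; congr (_ *: _ + _) => {x IHx a}.
elim: ts => [|t ts IHt]; first by rewrite !st1l.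
rewrite -!pre_w in IHu IHt *.
rewrite {1}st_pre stDr !st_pre stDl !st_pre.
rewrite IHu IHv -IHt -sig_st st_pre !sigD.
rewrite st_pre stDr preD stDl preD -!addrA; congr (_ + _).
by rewrite [LHS]addrCA; congr (_ + _); rewrite [LHS]addrCA.
Qed.

Lemma shuffle1l : left_id (w [::]) st. Proof. exact: st1l. Qed.
Lemma shuffle1r : right_id (w [::]) st. Proof. exact: st1r. Qed.
Lemma shuffleDl : left_distributive st +%R. Proof. exact: stDl. Qed.
Lemma shuffleDr : right_distributive st +%R. Proof. exact: stDr. Qed.
Lemma shuffleZl a x y : a *: st x y = st (a *: x) y.
Proof. by rewrite stZl. Qed.
Lemma shuffleZr a x y : a *: st x y = st x (a *: y).
Proof. by rewrite stZr. Qed.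

End ShuffleTheory.

Section TwistedShuffle.
Variables (k : fieldType) (X : choiceType) (cj : X -> X -> X).
Notation TX := (tensor k X).

(* Recursion on the right-hand word first, since the left-hand word is        *)
(* conjugated in the second summand; star_word_cons is the recursion read in  *)
(* the usual order.                                                           *)
Fixpoint star_word_rev (us ts : seq X) {struct us} : TX :=
  if us is u :: us' then
    (fix aux (ts : seq X) : TX :=
       if ts is t :: ts' then
         word [:: t] * aux ts' + (-1) ^+ size ts *:
           (word [:: u] * star_word_rev us' [seq cj s u | s <- ts])
       else word us) ts
  else word ts.

Definition star_word (ts us : seq X) : TX := star_word_rev us ts.

Lemma star_word_nil us : star_word [::] us = word us.
Proof. by case: us. Qed.

Lemma star_word_nilr ts : star_word ts [::] = word ts.
Proof. by []. Qed.

Lemma star_word_cons t ts u us :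
  star_word (t :: ts) (u :: us) =
    word [:: t] * star_word ts (u :: us) + (-1) ^+ size (t :: ts) *:
      (word [:: u] * star_word [seq cj s u | s <- t :: ts] us).
Proof. by []. Qed.

Definition star (x y : TX) : TX := lext (fun ts => lext (star_word ts) y) x.

Lemma word_ind (P : TX -> Prop) :
  P 0 -> (forall (a : k) ts x, P x -> P (a *: word ts + x)) -> forall x, P x.
Proof.
by move=> P0 PS x; rewrite [x]wordE; elim/big_rec: _ => // *; apply: PS.
Qed.

Lemma tensorC (a : k) (x : TX) : x * a%:MP = a%:MP * x.
Proof.
rewrite !malgM_def fgmulUg fgmulgU; apply: eq_bigr => m _.
by rewrite mulrC mulm1 mul1m.
Qed.

Definition tcons (t : X) (x : TX) : TX := word [:: t] * x.

Lemma tcons_linear t : linear (tcons t).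
Proof.
move=> a x y; rewrite /tcons mulrDr -(mul_malgC a x) mulrA tensorC -mulrA.
by rewrite mul_malgC.
Qed.

HB.instance Definition _ t :=
  GRing.isLinear.Build k TX TX *:%R (tcons t) (tcons_linear t).

Lemma tcons_word t s : tcons t (word s) = word (t :: s).
Proof. exact: wordM. Qed.

Lemma lextP a (f g : seq X -> TX) x :
  lext (fun s => a *: f s + g s) x = a *: lext f x + lext g x.
Proof.
rewrite /lext scaler_sumr -big_split /=; apply: eq_bigr => m _.
by rewrite scalerDr !scalerA mulrC.
Qed.

Lemma star1l : left_id (word [::]) star.
Proof.
exact: (shuffle1l word_ind (@lext_word k X TX) lextP star_word_nil).
Qed.

Lemma star1r : right_id (word [::]) star.
Proof. exact: (shuffle1r word_ind (@lext_word k X TX) star_word_nilr). Qed.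

Lemma starDl : left_distributive star +%R.
Proof. exact: (@shuffleDl k X TX (fun h => lext h)). Qed.

Lemma starDr : right_distributive star +%R.
Proof. exact: (@shuffleDr k X TX (fun h => lext h) _ lextP). Qed.

Lemma starZl (a : k) x y : a *: star x y = star (a *: x) y.
Proof. exact: (@shuffleZl k X TX (fun h => lext h)). Qed.

Lemma starZr (a : k) x y : a *: star x y = star x (a *: y).
Proof. exact: (@shuffleZr k X TX (fun h => lext h) _ lextP). Qed.

Lemma starA : (forall t u v, cj (cj t u) v = cj (cj t v) (cj u v)) ->
  associative star.
Proof.
move=> cjJ; exact: (@shuffleA k X cj TX word (fun h => lext h)
  (fun t => tcons t) star_word cjJ word_ind (@lext_word k X TX) lextP
  tcons_word star_word_nil star_word_nilr star_word_cons).
Qed.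

Lemma mcoeff_star1 t x : (star (word [:: t]) x)@_(FMonom [::]) = 0.
Proof.
have tc0 u y : (tcons u y)@_(FMonom [::]) = 0.
  elim/word_ind: y => [|a ts y IH]; first by rewrite linear0 mcoeff0.
  rewrite (tcons_linear u a) mcoeffD mcoeffZ IH tcons_word mcoeffU fmP.
  by rewrite mulr0 addr0.
elim/word_ind: x => [|a us x IH].
  by rewrite /star lext_word linear0 mcoeff0.
rewrite /star !lext_word in IH *; rewrite lext_is_linear.
rewrite mcoeffD mcoeffZ IH addr0 lext_word; case: us => [|u us].
  by rewrite star_word_nilr -tcons_word tc0 mulr0.
rewrite star_word_cons mcoeffD mcoeffZ -/(tcons t _) -/(tcons u _) !tc0.
by rewrite mulr0 addr0 mulr0.
Qed.

End TwistedShuffle.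

Section GeneratedSubalgebra.
Variables (k : fieldType) (A : algType k) (G : A -> Prop).

Definition subalg_pred (x : A) : bool := `[< subalg_gen G x >].

Lemma subalg_pred_closed : subalg_closed subalg_pred.
Proof.
split=> [|a x y /asboolP Gx /asboolP Gy|x y /asboolP Gx /asboolP Gy].
- by apply/asboolP; apply: subalg_gen1.
- by apply/asboolP; apply: subalg_genD.
- by apply/asboolP; apply: subalg_genM.
Qed.

HB.instance Definition _ :=
  GRing.isSubalgClosed.Build k A subalg_pred subalg_pred_closed.

Record subalg : predArgType :=
  SubAlg { subalg_val : A; _ : subalg_val \in subalg_pred }.

HB.instance Definition _ := [isSub for subalg_val].
HB.instance Definition _ := [Choice of subalg by <:].
HB.instance Definition _ := [SubChoice_isSubAlgebra of subalg by <:].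

Lemma subalg_inP x : G x -> x \in subalg_pred.
Proof. by move=> Gx; apply/asboolP; apply: subalg_gen_in. Qed.

Definition subalg_in x (Gx : G x) : subalg := Sub x (subalg_inP Gx).

End GeneratedSubalgebra.

Section SpanIdeal.
Variables (k : fieldType) (A : algType k) (X : Type) (gen : X -> A).

Definition words_span (B : seq X -> Prop) : A -> Prop :=
  lspan (fun x => exists2 ts, B ts & x = \prod_(t <- ts) gen t).

Lemma lspanD (G : A -> Prop) x y : lspan G x -> lspan G y -> lspan G (x + y).
Proof.
by elim=> [|a g z Gg _ IH] Gy; [rewrite add0r | rewrite -addrA; apply: lspan_cons; auto].
Qed.

Lemma lspanZ (G : A -> Prop) a x : lspan G x -> lspan G (a *: x).
Proof.
elim=> [|b g z Gg _ IH]; first by rewrite scaler0; apply: lspan0.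
by rewrite scalerDr scalerA; apply: lspan_cons.
Qed.

Lemma lspan_in (G : A -> Prop) x : G x -> lspan G x.
Proof.
by move=> Gx; rewrite -[x]addr0 -[x]scale1r; apply: lspan_cons => //; apply: lspan0.
Qed.

Lemma words_spanM B B' B'' x y :
  (forall s t, B s -> B' t -> B'' (s ++ t)) ->
  words_span B x -> words_span B' y -> words_span B'' (x * y).
Proof.
move=> BB Bx By; elim: Bx => [|a g z [s Bs ->] _ IH].
  by rewrite mul0r; apply: lspan0.
rewrite mulrDl -scalerAl; apply: lspanD => //; apply: lspanZ => {z IH}.
elim: By => [|b g' z [t Bt ->] _ IH]; first by rewrite mulr0; apply: lspan0.
rewrite mulrDr -scalerAr; apply: lspanD => //; apply: lspanZ.
by apply: lspan_in; exists (s ++ t); rewrite ?big_cat //=; apply: BB.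
Qed.

End SpanIdeal.

Section ShuffleAlgebra.
Variables (k : fieldType) (W : finCoxeter).

Lemma rconjJ (t u v : refl W) :
  rconj (rconj t u) v = rconj (rconj t v) (rconj u v).
Proof. by apply/val_inj; rewrite /= conjJg. Qed.

(* T(k^T) with the twisted shuffle, instead of concatenation, as its product; *)
(* the alias keeps the two ring structures apart.                             *)
Definition shuffle_alg : Type := tensor k (refl W).
Notation SA := shuffle_alg.
HB.instance Definition _ := GRing.Lmodule.on SA.

Let sh_neq0 : (word [::] : SA) != 0.
Proof. by rewrite word_nil oner_neq0. Qed.

HB.instance Definition _ := GRing.Zmodule_isNzRing.Build SA
  (starA (@rconjJ)) (@star1l k _ (@rconj W)) (@star1r k _ (@rconj W))
  (@starDl k _ (@rconj W)) (@starDr k _ (@rconj W)) sh_neq0.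

HB.instance Definition _ :=
  GRing.Lmodule_isLalgebra.Build k SA (@starZl k _ (@rconj W)).

HB.instance Definition _ :=
  GRing.Lalgebra_isAlgebra.Build k SA (@starZr k _ (@rconj W)).

Definition sh_gen (t : refl W) : SA := word [:: t].

Lemma sh_mulE (x y : SA) : x * y = star (@rconj W) x y.
Proof. by []. Qed.

Lemma mcoeff_sh_gen t (x : SA) :
  ((sh_gen t * x : SA) : tensor k (refl W))@_(FMonom [::]) = 0.
Proof. exact: mcoeff_star1. Qed.

Lemma mcoeff_sh1 : ((1 : SA) : tensor k (refl W))@_(FMonom [::]) = 1.
Proof. exact: mcoeffUU. Qed.

Definition nichols : Type := subalg (fun x : SA => exists t, x = sh_gen t).
HB.instance Definition _ := GRing.Algebra.on nichols.

Definition nich_gen (t : refl W) : nichols :=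
  subalg_in (ex_intro (fun u => sh_gen t = sh_gen u) t erefl).

Definition nich_comp (w : W) (j : nat) : nichols -> Prop :=
  lspan (fun x => exists ts, [/\ size ts = j, rprod ts = w
                               & x = \prod_(t <- ts) nich_gen t]).

(* The sum of the N_(w,j) is automatically direct, T(k^T) being graded by     *)
(* W x nat.                                                                   *)
Definition Jc (c : W) (x : nichols) : bool :=
  `[< lspan (fun y => exists w j, w \notin NC c j /\ nich_comp w j y) x >].

Variable c : W.

Let bad (ts : seq (refl W)) : Prop := rprod ts \notin NC c (size ts).

Let JcP x : reflect (words_span nich_gen bad x) (x \in Jc c).
Proof.
apply: (iffP idP) => [/asboolP|Bx]; last first.
  apply/asboolP; elim: Bx => [|a g z [ts Bts ->] _ IH]; first exact: lspan0.
  apply: lspan_cons => //; exists (rprod ts), (size ts); split => //.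
  by apply: lspan_in; exists ts.
elim=> [|a g z [w [j [wj gw]]] _ IH]; first exact: lspan0.
apply: lspanD => //; apply: lspanZ => {z IH}.
elim: gw => [|b g' z [ts [sz pr ->]] _ IH]; first exact: lspan0.
by apply: lspan_cons => //; exists ts; rewrite // /bad sz pr.
Qed.

Let nich_span x : words_span nich_gen (fun=> True) x.
Proof.
have [y /val_inj <- //] : exists2 y : nichols, val y = val x
    & words_span nich_gen (fun=> True) y.
have /asboolP := valP x; elim => [_ [t ->]||a y z _ [y' <- Sy] _ [z' <- Sz]|
                               y z _ [y' <- Sy] _ [z' <- Sz]].
- exists (nich_gen t) => //; apply: lspan_in; exists [:: t] => //.
  by rewrite big_seq1.
- exists 1; first exact: rmorph1.
  by apply: lspan_in; exists [::]; rewrite ?big_nil.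
- exists (a *: y' + z'); first by rewrite linearP.
  by apply: lspanD => //; apply: lspanZ.
- exists (y' * z'); first by rewrite rmorphM.
  exact: words_spanM Sy Sz.
Qed.

Let Jc_mul a b x : x \in Jc c -> a * x * b \in Jc c.
Proof.
move=> /JcP Jx; apply/JcP.
apply: (@words_spanM _ _ _ _ bad (fun=> True) bad) _ (nich_span b).
  by move=> s t Bs _; apply: contra Bs => h; apply: (@NC_factor _ _ [::] s t).
apply: (@words_spanM _ _ _ _ (fun=> True) bad bad) (nich_span a) Jx.
move=> s t _ Bt; apply: contra Bt => h.
by apply: (@NC_factor _ _ s t [::]); rewrite cats0.
Qed.

Let Jc_idealr : idealr_closed (Jc c).
Proof.
split.
- by apply/JcP; apply: lspan0.
- apply/negP => /JcP J1.
  pose aug (x : nichols) : k := (val x : tensor k (refl W))@_(FMonom [::]).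
  have /eqP : aug 1 = 0; last by rewrite /aug rmorph1 mcoeff_sh1 oner_eq0.
  elim: J1 => [|a g z [ts Bts ->] _ IH]; first exact: mcoeff0.
  have augP b x y : aug (b *: x + y) = b * aug x + aug y.
    by rewrite -mcoeffZ -mcoeffD; congr mcoeff.
  rewrite augP IH addr0.
  case: ts Bts => [|t ts _]; first by move=> /negP[]; rewrite /rprod big_nil; exact: NC1.
  by rewrite big_cons /aug rmorphM mcoeff_sh_gen mulr0.
- move=> a x y Jx /JcP Jy; apply/JcP; apply: lspanD => //.
  by apply/JcP; rewrite -[a * x]mulr1 Jc_mul.
Qed.

HB.instance Definition _ := isIdealr.Build nichols (Jc c) Jc_idealr.

Let Jc_right a x : x \in Jc c -> x * a \in Jc c.
Proof. by move=> Jx; rewrite -[x]mul1r Jc_mul. Qed.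

HB.instance Definition _ := isRightStable.Build nichols (Jc c) Jc_right.

End ShuffleAlgebra.

Section Algebras.
Variables (k : fieldType) (W : finCoxeter) (c : W).
Notation T := (refl W).

(* R: the span of the t (x) u - u (x) t^u with tu <=_T c.                     *)
Definition dual_braid_rel : {ffun T * T -> k^o} -> Prop :=
  lspan (fun r => exists t u : T, rle (val t * val u)%g c /\
    r = [ffun p => (p == (t, u))%:R - (p == (u, rconj t u))%:R]).

(* The monoid algebra k[D(W)] is T(k^T) / <R>.                                *)
Definition dual_braid_alg := quad_alg dual_braid_rel.

Definition Palg := quad_alg (quad_perp dual_braid_rel).
HB.instance Definition _ := GRing.Lalgebra.on Palg.

Definition Pgen (t : T) : Palg := quad_gen (quad_perp dual_braid_rel) t.

Definition Palg' := tsquot (Jc (k := k) c).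
HB.instance Definition _ := GRing.Lalgebra.on Palg'.

Definition Pproj (x : nichols k W) : Palg' := tspi (Jc (k := k) c) x.

End Algebras.
Arguments Pproj {k W} c x%_ring_scope.

(* Main.v *)
From HB Require Import structures.
Require Import Defs.
From mathcomp Require Import all_boot all_order all_algebra all_fingroup.
From mathcomp Require Import boolp Rstruct reals trigo monalg.
From mathcomp Require Import zify ring lra.

Set Implicit Arguments.
Unset Strict Implicit.
Unset Printing Implicit Defensive.

Import GRing.Theory Num.Theory Order.TTheory.
Local Open Scope ring_scope.

(* Order the reflections by the first time they appear when one conjugates by *)
(* the letters of c c c ... .  With the Euler form E of c on the geometric    *)
(* representation (E(b_t, b_u) = 0 when t u <=_T c, where b_t is the positive *)
(* root of t), a computation in the plane of b_t and b_u shows that every     *)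
(* w in NC_2 has a unique increasing factorization w = t u, and that t is     *)
(* then minimal among the first factors of w.  Hence the relation             *)
(* sum_(t u = w) x_t x_u = 0 rewrites every word of P(W,c) into decreasing    *)
(* words, while words whose product is not noncrossing vanish.  Conversely    *)
(* t_1 * ... * t_j (twisted shuffle) has all its first letters among the t_i, *)
(* so for decreasing words its leading term is t_1 (x) ... (x) t_j: the       *)
(* images of the decreasing words are linearly independent in the Nichols     *)
(* algebra, and the W x nat grading separates those in NC from J_c.           *)

(** Pairing a function on pairs of reflections with tu - ut^u shows that R^⊥ consists of the
    functions invariant under the Hurwitz move (t,u) -> (u,t^u) at every pair with tu <=_T c
    ([quad_perpP]). Since t ⋆ u = t⊗u - u⊗t^u, the part of such a function over [NC c 2] telescopes
    to zero under the shuffle product, and the rest lands in J_c ([evni_quad]). Hence the map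
    exists; it is onto because T generates the Nichols algebra.

    Injectivity ([evni_ker]) compares a spanning set with a free family. [NC_geometry] provides an
    injective ranking [N] of the reflections and a relation [e]. In the quadratic dual, words whose
    product is not noncrossing vanish ([word_not_NC]), and ascents are rewritten away
    ([reduce_word]), so decreasing noncrossing words span ([reduce]). In the shuffle algebra,
    stripping a leading letter is a skew derivation ([der_star]), which proves decreasing words
    independent ([decreasing_free]); the projection [nc_part] separates the noncrossing ones from
    J_c.

    The geometric input is an Euler form E with E(x, y - yc) = B(x,y) ([eul_diff]), where B is the
    Coxeter form. Any factorization of c into n reflections, n being the rank, yields a basis of
    roots ([coxeter_basis]), whence E vanishes on the two roots of a noncrossing pair ([fact_pair]).
    Conversely, a list on which E vanishes pairwise extends to a factorization of c
    ([complete_factorization]). Rotating the word of c reduces statements about the order to the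
    case where a reflection is the first letter ([ascent_unique]). *)

Section Chebyshev.
Variables (R : realType) (m : nat).
Hypothesis m_gt1 : (1 < m)%N.

Let theta : R := pi / m%:R.
(** This is U_{k-1}(cos(pi/m)) for the Chebyshev polynomials of the second kind: the coordinates of
    roots in a dihedral orbit. *)
Definition cheb (k : nat) : R := sin (k%:R * theta) / sin theta.

Let m_neq0 : m%:R != 0 :> R.
Proof. by rewrite pnatr_eq0; case: m m_gt1. Qed.

Let sin_theta_gt0 : 0 < sin theta.
Proof.
have m_gt0 : 0 < m%:R :> R by rewrite ltr0n ltnW.
apply: sin_gt0_pi; rewrite /theta divr_gt0 ?pi_gt0 //=.
by rewrite ltr_pdivrMr // ltr_pMr ?pi_gt0 // ltr1n.
Qed.

Lemma cheb0 : cheb 0 = 0.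
Proof. by rewrite /cheb mul0r sin0 mul0r. Qed.

Lemma cheb1 : cheb 1 = 1.
Proof. by rewrite /cheb mul1r divff // gt_eqF. Qed.

Lemma chebSS k : cheb k.+2 = 2 * cos (pi / m%:R) * cheb k.+1 - cheb k.
Proof.
rewrite /cheb -/theta; move: theta => th.
rewrite [2 * _ * _]mulrA -mulrBl; congr (_ / _).
have -> : k.+2%:R * th = k.+1%:R * th + th by rewrite -[k.+2%:R]natr1; ring.
have -> : k%:R * th = k.+1%:R * th - th by rewrite -[k.+1%:R]natr1; ring.
by rewrite sinD sinB; ring.
Qed.

Lemma cheb_ge0 k : (k <= m)%N -> 0 <= cheb k.
Proof.
move=> km; rewrite /cheb divr_ge0 ?(ltW sin_theta_gt0) //.
apply: sin_ge0_pi; rewrite mulr_ge0 ?ler0n ?divr_ge0 ?pi_ge0 //=.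
by rewrite /theta mulrCA ler_piMr ?pi_ge0 // ler_pdivrMr ?mul1r ?ler_nat // ltr0n ltnW.
Qed.

Lemma cheb_double : cheb m.*2 = 0.
Proof.
rewrite /cheb -muln2 natrM; have -> : m%:R * 2 * theta = pi *+ 2.
  by rewrite /theta; field.
by rewrite sin2pi mul0r.
Qed.

Lemma cheb_doubleS : cheb m.*2.+1 = 1.
Proof.
have -> : cheb m.*2.+1 = sin (theta + pi *+ 2) / sin theta.
  congr (sin _ / _); rewrite -muln2 -natr1 natrM /theta; field => //.
by rewrite sinD2pi divff // gt_eqF.
Qed.

Lemma cos_sq_lt1 : cos theta ^+ 2 < 1.
Proof. by have := cos2Dsin2 theta; have := sin_theta_gt0; nra. Qed.

End Chebyshev.

(** * The group of invertible matrices *)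

Section UnitMatrixGroup.
Variables (R : comUnitRingType) (n : nat).

(** The universal property in [coxeter_system] takes values in a [groupType], so invertible matrices
    of any size are packed into one. *)
Record umx : predArgType := UMx { uval : 'M[R]_n; _ : uval \in unitmx }.
HB.instance Definition _ := [isSub for uval].
HB.instance Definition _ := [Choice of umx by <:].

Let umx_mul (A B : umx) : umx.
Proof. by exists (val A *m val B); rewrite unitmx_mul !(valP A, valP B). Defined.
Let umx_one : umx := UMx (unitmx1 R n).
Let umx_inv (A : umx) : umx.
Proof. by exists (invmx (val A)); rewrite unitmx_inv (valP A). Defined.

Let umx_mulA : associative umx_mul.
Proof. by move=> A B C; apply/val_inj; rewrite /= mulmxA. Qed.
Let umx_mul1 : left_id umx_one umx_mul.
Proof. by move=> A; apply/val_inj; rewrite /= mul1mx. Qed.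
Let umx_mulr1 : right_id umx_one umx_mul.
Proof. by move=> A; apply/val_inj; rewrite /= mulmx1. Qed.
Let umx_mulV : left_inverse umx_one umx_inv umx_mul.
Proof. by move=> A; apply/val_inj; rewrite /= mulVmx // (valP A). Qed.
Let umx_mulrV : right_inverse umx_one umx_inv umx_mul.
Proof. by move=> A; apply/val_inj; rewrite /= mulmxV // (valP A). Qed.

HB.instance Definition _ :=
  isGroup.Build umx umx_mulA umx_mul1 umx_mulr1 umx_mulV umx_mulrV.

End UnitMatrixGroup.

(** * The geometric representation *)

Section Geometric.
Variables (R : realType) (W : finCoxeter).
Local Notation n := #|simple_refl W|.
Local Notation V := 'rV[R]_n.
Implicit Types (i j : 'I_n) (x y z v : V).

Definition simple i : W := enum_val i.
Definition cox_order i j : nat := #[(simple i * simple j)%g]%g.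
(** Twice the usual normalization: roots have norm 2, and a reflection is v - B(v,x)x. *)
Definition cox_form : 'M[R]_n :=
  \matrix_(i, j) (- (2 * cos (pi / (cox_order i j)%:R))).
Definition bf x y : R := (x *m cox_form *m y^T) 0 0.
Definition sroot i : V := delta_mx 0 i.
Definition simple_mx i : 'M[R]_n := 1%:M - cox_form *m delta_mx i i.

Lemma simple_in i : simple i \in simple_refl W.
Proof. exact: enum_valP. Qed.

Lemma order_simple i : #[simple i]%g = 2.
Proof. by have [_ ord2 _] := finCoxeterP W; apply: ord2; apply: simple_in. Qed.

Lemma simpleK i : (simple i * simple i = 1)%g.
Proof. by have := expg_order (simple i); rewrite order_simple expgS expg1. Qed.

Lemma simpleV i : (simple i)^-1%g = simple i.
Proof. by apply/eqP; rewrite eq_invg_mul simpleK. Qed.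

Lemma simple_inj : injective simple.
Proof. exact: enum_val_inj. Qed.

Lemma cox_orderC i j : cox_order i j = cox_order j i.
Proof.
rewrite /cox_order -[RHS]orderV invMg !simpleV //.
Qed.

Lemma cox_order_gt1 i j : i != j -> (1 < cox_order i j)%N.
Proof.
move=> ij; rewrite /cox_order ltn_neqAle order_gt0 andbT eq_sym order_eq1.
apply: contra ij => /eqP sij; apply/eqP/simple_inj.
by rewrite -[simple j]mul1g -(simpleK i) -mulgA sij mulg1.
Qed.

Lemma cox_formE i j : cox_form i j = - (2 * cos (pi / (cox_order i j)%:R)).
Proof. by rewrite mxE. Qed.

Lemma cox_formC i j : cox_form i j = cox_form j i.
Proof. by rewrite !cox_formE cox_orderC. Qed.

Lemma cox_form_diag i : cox_form i i = 2.
Proof. by rewrite cox_formE /cox_order simpleK order1 divr1 cospi; ring. Qed.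

Lemma cox_form_le0 i j : i != j -> cox_form i j <= 0.
Proof.
move=> /cox_order_gt1; rewrite cox_formE; move: (cox_order _ _) => m m1.
rewrite oppr_le0 mulr_ge0 //; apply: cos_ge0_pihalf.
have m0 : 0 < m%:R :> R by rewrite ltr0n ltnW.
have p0 := pi_gt0 R.
have q0 : 0 <= pi / m%:R :> R by rewrite divr_ge0 ?ltW.
apply/andP; split; first by lra.
by rewrite ler_pM2l // lef_pV2 ?posrE // ler_nat.
Qed.

Lemma bf_is_linear x : linear_for *%R (bf x).
Proof.
by move=> a y z; rewrite /bf linearD linearZ /= mulmxDr -scalemxAr !mxE.
Qed.
HB.instance Definition _ x :=
  GRing.isLinear.Build R V R *%R (bf x) (bf_is_linear x).

Lemma bfC x y : bf x y = bf y x.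
Proof.
rewrite /bf -[x *m _ *m _]trmxK [LHS]mxE !trmx_mul trmxK mulmxA.
by congr ((_ *m _ *m _) _ _); apply/matrixP=> i j; rewrite mxE cox_formC.
Qed.

Lemma bfDl x y z : bf (x + y) z = bf x z + bf y z.
Proof. by rewrite !(bfC _ z) linearD. Qed.
Lemma bfZl a x y : bf (a *: x) y = a * bf x y.
Proof. by rewrite !(bfC _ y) linearZ. Qed.
Lemma bfNl x y : bf (- x) y = - bf x y.
Proof. by rewrite !(bfC _ y) linearN. Qed.
Lemma bfBl x y z : bf (x - y) z = bf x z - bf y z.
Proof. by rewrite bfDl bfNl. Qed.
Lemma bfDr x y z : bf x (y + z) = bf x y + bf x z.
Proof. exact: linearD. Qed.
Lemma bfZr a x y : bf x (a *: y) = a * bf x y.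
Proof. by rewrite bfC bfZl bfC. Qed.
Lemma bfNr x y : bf x (- y) = - bf x y.
Proof. exact: linearN. Qed.
Lemma bfBr x y z : bf x (y - z) = bf x y - bf x z.
Proof. exact: linearB. Qed.
Lemma bf0l x : bf 0 x = 0.
Proof. by rewrite bfC linear0. Qed.

Lemma bf_srootr x i : bf x (sroot i) = \sum_j x 0 j * cox_form j i.
Proof. by rewrite /bf /sroot trmx_delta -colE !mxE. Qed.

Lemma bf_sroot i j : bf (sroot i) (sroot j) = cox_form i j.
Proof.
rewrite bf_srootr (bigD1 i) //= mxE !eqxx mul1r big1 ?addr0 // => l li.
by rewrite mxE (negPf li) andbF mul0r.
Qed.

Lemma mul_simple_mx v i : v *m simple_mx i = v - bf v (sroot i) *: sroot i.
Proof.
rewrite /simple_mx mulmxBr mulmx1 mulmxA; congr (_ - _); apply/rowP => j.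
rewrite /bf /sroot trmx_delta -colE.
rewrite -(mul_delta_mx (0 : 'I_1)) mulmxA -colE.
by rewrite [in LHS]mxE big_ord1 [in RHS]mxE.
Qed.

Lemma simple_mxK i : simple_mx i *m simple_mx i = 1%:M.
Proof.
apply/row_matrixP => l; rewrite -[simple_mx i *m _]mul1mx mulmxA.
rewrite !row_mul !mul_simple_mx bfBl bfZl bf_sroot cox_form_diag.
by move: (row l _) => x; apply/rowP => q; rewrite !mxE; ring.
Qed.

Lemma bf_simple_mx x y i : bf (x *m simple_mx i) (y *m simple_mx i) = bf x y.
Proof.
rewrite !mul_simple_mx !(bfBl, bfBr, bfZl, bfZr) !(bfC (sroot i)) bf_sroot.
by rewrite cox_form_diag; ring.
Qed.

Lemma simple_mx_unit i : simple_mx i \in unitmx.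
Proof. by case: (mulmx1_unit (simple_mxK i)). Qed.

Section Dihedral.
Variables (i j : 'I_n).
Hypothesis ij : i != j.
Local Notation p := (cheb R (cox_order i j)).

Let form_ij : cox_form i j = - (2 * cos (pi / (cox_order i j)%:R)).
Proof. exact: cox_formE. Qed.

Lemma cheb_simple_i k :
  (p k *: sroot i + p k.+1 *: sroot j) *m simple_mx i =
  p k.+2 *: sroot i + p k.+1 *: sroot j.
Proof.
rewrite mul_simple_mx bfDl !bfZl !bf_sroot cox_form_diag cox_formC form_ij.
rewrite chebSS; apply/rowP => l; rewrite !mxE; ring.
Qed.

Lemma cheb_simple_j k :
  (p k *: sroot j + p k.+1 *: sroot i) *m simple_mx j =
  p k.+2 *: sroot j + p k.+1 *: sroot i.
Proof.
rewrite mul_simple_mx bfDl !bfZl !bf_sroot cox_form_diag form_ij.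
rewrite chebSS; apply/rowP => l; rewrite !mxE; ring.
Qed.

Lemma cheb_dihedral k :
  sroot j *m iter k (mulmx (simple_mx i *m simple_mx j)) 1%:M =
  p k.*2 *: sroot i + p k.*2.+1 *: sroot j.
Proof.
elim: k => [|k IHk].
  by rewrite cheb0 cheb1 ?cox_order_gt1 // scale0r scale1r add0r mulmx1.
have -> : iter k.+1 (mulmx (simple_mx i *m simple_mx j)) 1%:M =
  iter k (mulmx (simple_mx i *m simple_mx j)) 1%:M *m (simple_mx i *m simple_mx j).
  elim: k {IHk} => [|k IHk]; first by rewrite /= mulmx1 mul1mx.
  by rewrite iterS {1}IHk !mulmxA.
by rewrite mulmxA IHk mulmxA cheb_simple_i addrC cheb_simple_j addrC.
Qed.

End Dihedral.

(** The power fixes both simple roots, since the Chebyshev coefficients return to (0,1) at index 2m,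
    and it fixes every vector orthogonal to both. These vectors span, because the Gram determinant 4
    - c^2 of the plane is nonzero. *)
Lemma dihedral_mx i j : i != j ->
  iter (cox_order i j) (mulmx (simple_mx i *m simple_mx j)) 1%:M = 1%:M.
Proof.
move=> ij; set m := cox_order i j; set D := _ *m _; set A := iter _ _ _.
have m1 : (1 < m)%N by apply: cox_order_gt1.
have fixj : sroot j *m A = sroot j.
  by rewrite cheb_dihedral // cheb_double // cheb_doubleS // scale0r scale1r add0r.
have fixi : sroot i *m A = sroot i.
  have : sroot i *m iter m (mulmx (simple_mx j *m simple_mx i)) 1%:M = sroot i.
    rewrite cheb_dihedral 1?eq_sym // cox_orderC -/m cheb_double //.
    by rewrite cheb_doubleS // scale0r scale1r add0r.
  (* The power taken in the opposite order is the inverse of [A], so a vector fixed by one is fixed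
     by the other. *)
  have AA : iter m (mulmx (simple_mx j *m simple_mx i)) 1%:M *m A = 1%:M.
    have DD : simple_mx j *m simple_mx i *m D = 1%:M.
      by rewrite /D mulmxA -[X in X *m _]mulmxA simple_mxK mulmx1 simple_mxK.
    have itC k (M : 'M[R]_n) : iter k.+1 (mulmx M) 1%:M = iter k (mulmx M) 1%:M *m M.
      elim: k => [|k IHk]; first by rewrite /= mulmx1 mul1mx.
      by rewrite iterS {1}IHk !mulmxA.
    rewrite /A; elim: m {A fixj m1} => [|k IHk]; first by rewrite mulmx1.
    by rewrite itC [X in _ *m X]iterS mulmxA -[X in X *m _]mulmxA DD mulmx1.
  by move=> fx; rewrite -{1}fx -mulmxA AA mulmx1.
have fixo x : bf x (sroot i) = 0 -> bf x (sroot j) = 0 -> x *m A = x.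
  move=> xi xj; rewrite /A; elim: m {A fixi fixj m1} => [|k IHk]; first exact: mulmx1.
  by rewrite iterS mulmxA /D mulmxA !mul_simple_mx xi !scale0r subr0 xj scale0r subr0.
apply/row_matrixP => l; rewrite -[A]mul1mx row_mul; set x := row l _.
pose c : R := 2 * cos (pi / m%:R).
have c4 : 4 - c ^+ 2 != 0.
  by have := cos_sq_lt1 R m1; rewrite /c => cs; apply: lt0r_neq0; nra.
have Cij : cox_form i j = - c by rewrite cox_formE.
(* [a] and [b] solve the two-by-two system for the component of [x] in the plane of the two
   roots. *)
pose a := (2 * bf x (sroot i) + c * bf x (sroot j)) / (4 - c ^+ 2).
pose b := (c * bf x (sroot i) + 2 * bf x (sroot j)) / (4 - c ^+ 2).
have -> : x = (x - (a *: sroot i + b *: sroot j)) + (a *: sroot i + b *: sroot j).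
  by rewrite subrK.
rewrite mulmxDl; congr (_ + _); last by rewrite mulmxDl -!scalemxAl fixi fixj.
apply: fixo; rewrite bfBl bfDl !bfZl !bf_sroot cox_form_diag.
  by rewrite cox_formC Cij /a /b; field.
by rewrite Cij /a /b; field.
Qed.

Lemma geometric_rep : exists rho : W -> 'M[R]_n,
  [/\ rho 1%g = 1%:M, forall w w', rho (w * w')%g = rho w *m rho w'
    & forall i, rho (simple i) = simple_mx i].
Proof.
have [_ _ univ] := finCoxeterP W.
(* Off the simple reflections [f] takes the default value 1, which the universal property never
   inspects. *)
pose f (w : W) : umx R n :=
  if [pick i | simple i == w] is Some i then UMx (simple_mx_unit i) else 1%g.
have fE i : f (simple i) = UMx (simple_mx_unit i).
  rewrite /f; case: pickP => [i' /eqP/simple_inj -> //|/(_ i)].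
  by rewrite eqxx.
have rel : {in simple_refl W &, forall s t, ((f s * f t) ^+ #[s * t])%g = 1%g}.
  have simpleP s : s \in simple_refl W -> exists i, s = simple i.
    by move=> Ss; exists (enum_rank_in Ss s); rewrite /simple enum_rankK_in.
  move=> _ _ /simpleP[i ->] /simpleP[j ->]; rewrite !fE.
  apply/val_inj.
  have -> k : val ((UMx (simple_mx_unit i) * UMx (simple_mx_unit j)) ^+ k)%g =
     iter k (mulmx (simple_mx i *m simple_mx j)) 1%:M.
    by elim: k => [|k IHk] //; rewrite expgS iterS -IHk.
  have [<-|ij] := eqVneq i j; last exact: dihedral_mx.
  by rewrite simpleK order1 /= mulmx1 simple_mxK.
have [phi phiM phiE] := univ _ f rel.
have phi1 : phi 1%g = 1%g.
  by apply: (@mulgI _ (phi 1%g)); rewrite -phiM !mulg1.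
exists (fun w => uval (phi w)); split=> [|w w'|i].
- by rewrite phi1.
- by rewrite phiM.
- by rewrite phiE ?simple_in // fE.
Qed.

End Geometric.

(** * Length and root positivity *)

Section Length.
Variable W : finCoxeter.
Local Notation n := #|simple_refl W|.
Implicit Types (i j : 'I_n) (w : W) (l : seq 'I_n).

Definition wprod l : W := (\prod_(i <- l) simple i)%g.

Lemma wprod_cat l l' : wprod (l ++ l') = (wprod l * wprod l')%g.
Proof. exact: big_cat. Qed.

Lemma wprod_cons i l : wprod (i :: l) = (simple i * wprod l)%g.
Proof. exact: big_cons. Qed.

Lemma wprod_nil : wprod [::] = 1%g.
Proof. exact: big_nil. Qed.

Lemma ex_wprod w : exists l, wprod l = w.
Proof.
have [gS _ _] := finCoxeterP W.
have : w \in <<simple_refl W>>%g by rewrite gS inE.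
case/gen_prodgP => m [f Sf ->]; elim: m f Sf => [|m IH] f Sf.
  by exists [::]; rewrite wprod_nil big_ord0.
rewrite big_ord_recl.
have [l <-] := IH (fun r => f (lift ord0 r)) (fun r => Sf _).
exists (enum_rank_in (Sf ord0) (f ord0) :: l).
by rewrite wprod_cons /simple enum_rankK_in.
Qed.

Lemma ex_slen w : exists k, [exists l : k.-tuple 'I_n, wprod l == w].
Proof.
by have [l <-] := ex_wprod w; exists (size l); apply/existsP; exists (in_tuple l).
Qed.

Definition slen w : nat := ex_minn (ex_slen w).

Lemma slen_le l : (slen (wprod l) <= size l)%N.
Proof.
rewrite /slen; case: ex_minnP => m _; apply.
by apply/existsP; exists (in_tuple l).
Qed.

Lemma slen_word w : exists2 l, size l = slen w & wprod l = w.
Proof.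
rewrite /slen; case: ex_minnP => m /existsP[l /eqP <-] _.
by exists l; rewrite ?size_tuple.
Qed.

Lemma slenM w w' : (slen (w * w')%g <= slen w + slen w')%N.
Proof.
have [s <- <-] := slen_word w; have [t <- <-] := slen_word w'.
by rewrite -wprod_cat -size_cat slen_le.
Qed.

Lemma slenV w : (slen w^-1%g <= slen w)%N.
Proof.
have [s <- <-] := slen_word w; rewrite -size_rev.
suff -> : ((wprod s)^-1 = wprod (rev s))%g by apply: slen_le.
elim: s => [|i s IHs]; first by rewrite wprod_nil invg1.
by rewrite wprod_cons invMg IHs simpleV rev_cons -cats1 wprod_cat wprod_cons wprod_nil mulg1.
Qed.

Lemma slen_simple i : (slen (simple i) <= 1)%N.
Proof. by have := slen_le [:: i]; rewrite wprod_cons wprod_nil mulg1. Qed.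

Lemma slen_mull i w : (slen (simple i * w)%g <= (slen w).+1)%N.
Proof. by apply: leq_trans (slenM _ _) _; rewrite -add1n leq_add2r slen_simple. Qed.

Lemma slen_mull' i w : (slen w <= (slen (simple i * w)%g).+1)%N.
Proof.
by rewrite -{1}[w]mul1g -(simpleK i) -mulgA slen_mull.
Qed.

Lemma slen1 : slen 1%g = 0.
Proof. by apply/eqP; rewrite -leqn0 -wprod_nil slen_le. Qed.

Lemma slen_descent w : w != 1%g -> exists i, (slen (simple i * w)%g < slen w)%N.
Proof.
have [[|i l] <- <-] := slen_word w; first by rewrite wprod_nil eqxx.
move=> _; exists i; rewrite ltnS wprod_cons mulgA simpleK mul1g.
exact: slen_le.
Qed.

Fixpoint alt i j k : W :=
  if k is k'.+1 then (simple i * alt j i k')%g else 1%g.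

Lemma altD i j a b : alt i j (a + b) =
  (alt i j a * alt (if odd a then j else i) (if odd a then i else j) b)%g.
Proof.
elim: a i j => [|a IHa] i j; first by rewrite mul1g.
by rewrite addSn /= IHa mulgA; case: (odd a).
Qed.

Lemma altSr i j k : alt i j k.+1 = (alt i j k * simple (if odd k then j else i))%g.
Proof. by rewrite -addn1 altD /= mulg1. Qed.

Lemma alt_double i j k : alt i j k.*2 = ((simple i * simple j) ^+ k)%g.
Proof. by elim: k => // k IHk; rewrite doubleS expgS -IHk /= mulgA. Qed.

Lemma slen_alt i j k : (slen (alt i j k) <= k)%N.
Proof.
elim: k i j => [|k IHk] i j; first by rewrite slen1.
by apply: leq_trans (slen_mull _ _) _; rewrite ltnS IHk.
Qed.

(** The alternating word of 2m letters is trivial, so its first m+1 letters are inverse to its last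
    m-1. *)
Lemma slen_alt_order i j : i != j ->
  (slen (alt i j (cox_order i j).+1) < cox_order i j)%N.
Proof.
move=> ij; have := cox_order_gt1 ij; set m := cox_order i j => m1.
have : alt i j (m.+1 + m.-1) = 1%g.
  have -> : (m.+1 + m.-1 = m.*2)%N by lia.
  by rewrite alt_double expg_order.
rewrite altD => /eqP; rewrite -eq_invg_mul => /eqP altV.
rewrite -[alt i j m.+1]invgK; apply: leq_ltn_trans (slenV _) _.
rewrite altV; apply: leq_ltn_trans (slen_alt _ _ _) _; lia.
Qed.

End Length.

Section Roots.
Variables (R : realType) (W : finCoxeter).
Local Notation n := #|simple_refl W|.
Local Notation V := 'rV[R]_n.
Variable rho : W -> 'M[R]_n.
Hypothesis rho1 : rho 1%g = 1%:M.
Hypothesis rhoM : forall w w', rho (w * w')%g = rho w *m rho w'.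
Hypothesis rhoS : forall i, rho (simple i) = simple_mx R i.
Implicit Types (i j : 'I_n) (w : W) (l : seq 'I_n) (x y z v : V).
Local Notation sroot := (@sroot R W).

Definition pos v := [forall i, 0 <= v 0 i].

Lemma posP v : reflect (forall i, 0 <= v 0 i) (pos v).
Proof. exact: forallP. Qed.

Lemma posD x y : pos x -> pos y -> pos (x + y).
Proof.
by move=> /posP px /posP py; apply/posP => i; rewrite mxE addr_ge0.
Qed.

Lemma posZ a x : 0 <= a -> pos x -> pos (a *: x).
Proof. by move=> a0 /posP px; apply/posP => i; rewrite mxE mulr_ge0. Qed.

Lemma pos_sroot i : pos (sroot i).
Proof. by apply/posP => j; rewrite mxE ler0n. Qed.

Lemma pos_anti x : pos x -> pos (- x) -> x = 0.
Proof.
move=> /posP px /posP pNx; apply/rowP => i; apply/eqP.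
by rewrite mxE eq_le px andbT -oppr_ge0; have := pNx i; rewrite mxE.
Qed.

Lemma bf_rho w x y : bf (x *m rho w) (y *m rho w) = bf x y.
Proof.
have [l <-] := ex_wprod w; elim: l x y => [|i l IHl] x y.
  by rewrite wprod_nil rho1 !mulmx1.
by rewrite wprod_cons rhoM !mulmxA IHl rhoS bf_simple_mx.
Qed.

Lemma rhoVK w v : v *m rho w^-1%g *m rho w = v.
Proof. by rewrite -mulmxA -rhoM mulVg rho1 mulmx1. Qed.

Lemma cheb_alt i j k q : i != j -> exists a b,
  [/\ (a <= q + k.+1)%N, (b <= q + k.+1)%N &
  (cheb R (cox_order i j) q *: sroot i + cheb R (cox_order i j) q.+1 *: sroot j)
     *m rho (alt i j k) =
  cheb R (cox_order i j) a *: sroot i + cheb R (cox_order i j) b *: sroot j].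
Proof.
elim: k i j q => [|k IHk] i j q ij.
  by exists q, q.+1; rewrite rho1 mulmx1; split; rewrite ?addn1.
have [|a [b [ale ble E]]] := IHk j i q.+1; first by rewrite eq_sym.
exists b, a; split; [lia | lia | ].
rewrite /= rhoM rhoS mulmxA cheb_simple_i // [X in X *m _]addrC.
by move: E; rewrite cox_orderC => ->; rewrite addrC.
Qed.

(* Strip from w the longest prefix alternating between the letters j and i:  *)
(* the rest sends both simple roots to nonnegative vectors, and the prefix   *)
(* sends [sroot i] to a combination with coefficients sin (k th) / sin th.   *)
Lemma pos_simple_act w i : (slen w <= slen (simple i * w)%g)%N ->
  pos (sroot i *m rho w).
Proof.
have [N] := ubnP (slen w); elim: N w i => // N IHN w i; rewrite ltnS => wN asc.
have [->|w1] := eqVneq w 1%g; first by rewrite rho1 mulmx1 pos_sroot.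
have [j desc] := slen_descent w1.
have ji : j != i by apply: contraTneq desc => ->; rewrite -leqNgt.
pose P k := (slen ((alt j i k)^-1 * w)%g + k == slen w)%N.
have P1 : exists k, P k.
  exists 1%N; rewrite /P /= mulg1 simpleV addn1 eqn_leq desc.
  exact: slen_mull'.
have Pub k : P k -> (k <= slen w)%N by rewrite /P; lia.
case: (ex_maxnP P1 Pub) => k Pk kmax.
have k_gt0 : (0 < k)%N.
  apply: (kmax 1%N); rewrite /P /= mulg1 simpleV addn1 eqn_leq desc.
  exact: slen_mull'.
move: Pk; rewrite /P; set v := (_ * w)%g => /eqP vk.
have wE : w = (alt j i k * v)%g by rewrite mulKVg.
have next : (slen v <= slen (simple (if odd k then i else j) * v)%g)%N.
  rewrite leqNgt; apply/negP => lt; have := slen_mull' (if odd k then i else j) v.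
  move=> le; have /kmax : P k.+1; last by rewrite ltnn.
  rewrite /P altSr invMg simpleV -mulgA -/v -vk addnS eqn_leq.
  by rewrite -!addSn !leq_add2r; apply/andP; split.
have prev : (slen v <= slen (simple (if odd k then j else i) * v)%g)%N.
  rewrite leqNgt; apply/negP => lt.
  have : (slen w <= k.-1 + slen (simple (if odd k then j else i) * v)%g)%N.
    have -> : w = (alt j i k.-1 * (simple (if odd k then j else i) * v))%g.
      rewrite wE -{1}(prednK k_gt0) altSr -mulgA; congr (_ * (simple _ * _))%g.
      by rewrite -{2}(prednK k_gt0) /=; case: odd.
    by apply: leq_trans (slenM _ _) _; rewrite leq_add2r slen_alt.
  by lia.
have vlt : (slen v < N)%N by lia.
have posi : pos (sroot i *m rho v).
  by apply: IHN => //; move: next prev; case: odd.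
have posj : pos (sroot j *m rho v).
  by apply: IHN => //; move: next prev; case: odd.
(* Otherwise s_i w would begin with m+1 alternating letters, which [slen_alt_order] shortens to
   fewer than m, against [asc]. The bound keeps all sine coefficients nonnegative. *)
have km : (k < cox_order j i)%N.
  rewrite ltnNge; apply/negP => mk.
  have ij : i != j by rewrite eq_sym.
  have := slen_alt_order ij; rewrite cox_orderC; set m := cox_order j i => sm.
  have sE : (simple i * w = alt i j m.+1 * (alt (if odd m then i else j)
      (if odd m then j else i) (k - m) * v))%g.
    by rewrite wE -{1}(subnKC mk) altD !mulgA.
  move: asc; rewrite sE.
  have := slenM (alt i j m.+1) (alt (if odd m then i else j)
      (if odd m then j else i) (k - m) * v)%g.
  have := slenM (alt (if odd m then i else j) (if odd m then j else i) (k - m)) v.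
  have := slen_alt (if odd m then i else j) (if odd m then j else i) (k - m).
  move: mk; rewrite -/m; lia.
have := cheb_alt k 0 ji; rewrite cheb0 scale0r add0r cheb1 ?cox_order_gt1 //.
rewrite scale1r => -[a [b [ale ble E]]].
rewrite wE rhoM mulmxA E mulmxDl -!scalemxAl.
apply: posD; apply: posZ => //; apply: cheb_ge0; rewrite ?cox_order_gt1 //; lia.
Qed.

Lemma root_sign w i :
  pos (sroot i *m rho w) \/ pos (- (sroot i *m rho w)).
Proof.
have [le|lt] := leqP (slen w) (slen (simple i * w)%g).
  by left; apply: pos_simple_act.
right; rewrite -mulNmx.
have -> : - sroot i = sroot i *m simple_mx R i.
  rewrite mul_simple_mx bf_sroot cox_form_diag scalerDl scale1r opprD addrA.
  by rewrite subrr add0r.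
by rewrite -rhoS -mulmxA -rhoM; apply: pos_simple_act; rewrite mulgA simpleK mul1g ltnW.
Qed.

(** If w is nontrivial with descent i, then s_i w keeps the simple root of i positive; if w acted
    trivially, s_i w would negate it. *)
Lemma rho_inj : injective rho.
Proof.
move=> w w' ww'; apply/eqP; rewrite eq_mulgV1; apply/eqP.
have {ww'} : rho (w * w'^-1)%g = 1%:M by rewrite rhoM ww' -rhoM mulgV rho1.
move: (w * _)%g => {w'}w w1; apply/eqP/negPn/negP => /slen_descent[i lt].
have : pos (sroot i *m rho (simple i * w)%g).
  by apply: pos_simple_act; rewrite mulgA simpleK mul1g ltnW.
rewrite rhoM w1 mulmx1 rhoS mul_simple_mx bf_sroot cox_form_diag.
by move=> /posP/(_ i); rewrite !mxE !eqxx /=; lra.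
Qed.

Definition is_root_of (t : refl W) (x : V) : Prop :=
  [/\ pos x, bf x x = 2 & forall v, v *m rho (val t) = v - bf v x *: x].

(** Evaluating both reflection formulas at x gives B(x,y)y = 2x, hence B(x,y) = ±2. *)
Lemma root_pm (t : refl W) x y : bf x x = 2 -> bf y y = 2 ->
  (forall v, v *m rho (val t) = v - bf v x *: x) ->
  (forall v, v *m rho (val t) = v - bf v y *: y) -> x = y \/ x = - y.
Proof.
move=> nx ny rx ry; have := rx x; rewrite ry nx => E.
have E' : bf x y *: y = x *+ 2.
  rewrite mulr2n; apply: (addrI (- x)); apply: oppr_inj.
  by move: E; rewrite scalerDl scale1r !opprD opprK => ->; rewrite addrA subrr.
have bb : bf x y ^+ 2 = 4.
  have : bf (bf x y *: y) x = bf (x *+ 2) x by rewrite E'.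
  by rewrite bfZl bfC expr2 => ->; rewrite mulr2n bfDl nx; ring.
have : (bf x y - 2) * (bf x y + 2) = 0 by lra.
move=> /eqP; rewrite mulf_eq0 => /orP[/eqP b2|/eqP b2]; [left|right].
  have b2' : bf x y = 2 by lra.
  by apply/rowP => i; have /rowP/(_ i) := E'; rewrite b2' mulr2n !mxE; lra.
have b2' : bf x y = - 2 by lra.
by apply/rowP => i; have /rowP/(_ i) := E'; rewrite b2' mulr2n !mxE; lra.
Qed.

Lemma ex_root t : exists x, is_root_of t x.
Proof.
have /imset2P[s w Ss _ tE] := valP t.
pose i := enum_rank_in Ss s.
have sE : s = simple i by rewrite /simple enum_rankK_in.
have nx : bf (sroot i *m rho w) (sroot i *m rho w) = 2.
  by rewrite bf_rho bf_sroot cox_form_diag.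
have rx v : v *m rho (val t) = v - bf v (sroot i *m rho w) *: (sroot i *m rho w).
  rewrite tE sE conjgE !rhoM rhoS !mulmxA mul_simple_mx mulmxBl rhoVK -scalemxAl.
  by congr (_ - _ *: _); rewrite -(bf_rho w) rhoVK.
have [pp|pn] := root_sign w i; first by exists (sroot i *m rho w).
exists (- (sroot i *m rho w)); split => //; first by rewrite bfNl bfNr opprK.
by move=> v; rewrite bfNr scalerN scaleNr opprK.
Qed.

End Roots.

(** * The Euler form of a Coxeter word *)

Section EulerForm.
Variables (R : realType) (W : finCoxeter).
Local Notation n := #|simple_refl W|.
Local Notation V := 'rV[R]_n.
Implicit Types (i j a : 'I_n) (w : W) (l : seq 'I_n) (x y z v : V).
Local Notation sroot := (@sroot R W).
Local Notation M := (cox_form R W).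

Definition supp l x := forall i, i \notin l -> x 0 i = 0.

Definition lsum l a x : R := \sum_(i <- l) x 0 i * M i a.

(* Right action: v s_i = v - B(v, a_i) a_i. The form [eul l] is unipotent and *)
(* triangular in the simple roots ordered by l, and [eul_diff] characterises *)
(* it by the Coxeter element of l alone.                                     *)
Fixpoint eul l x y : R :=
  if l is a :: l' then y 0 a * (x 0 a + lsum l' a x) + eul l' x y else 0.

Lemma lsum_linear l a : linear_for *%R (lsum l a).
Proof.
move=> k x y; rewrite /lsum mulr_sumr -big_split /=; apply: eq_bigr => i _.
by rewrite !mxE; ring.
Qed.

Lemma eul_linearl l x y z k : eul l (k *: x + y) z = k * eul l x z + eul l y z.
Proof.
elim: l => [|a l IHl] /=; first by ring.
by rewrite IHl lsum_linear !mxE; ring.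
Qed.

Lemma eul_linearr l x y z k : eul l x (k *: y + z) = k * eul l x y + eul l x z.
Proof.
elim: l => [|a l IHl] /=; first by ring.
by rewrite IHl !mxE; ring.
Qed.

Lemma eul0l l y : eul l 0 y = 0.
Proof. by have := eul_linearl l 0 0 y 1; rewrite scale1r addr0; lra. Qed.

Lemma eul0r l x : eul l x 0 = 0.
Proof. by have := eul_linearr l x 0 0 1; rewrite scale1r addr0; lra. Qed.

Lemma eulDl l x y z : eul l (x + y) z = eul l x z + eul l y z.
Proof. by have := eul_linearl l x y z 1; rewrite scale1r mul1r. Qed.
Lemma eulZl l k x z : eul l (k *: x) z = k * eul l x z.
Proof. by have := eul_linearl l x 0 z k; rewrite addr0 eul0l addr0. Qed.
Lemma eulDr l x y z : eul l x (y + z) = eul l x y + eul l x z.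
Proof. by have := eul_linearr l x y z 1; rewrite scale1r mul1r. Qed.
Lemma eulZr l k x z : eul l x (k *: z) = k * eul l x z.
Proof. by have := eul_linearr l x z 0 k; rewrite addr0 eul0r addr0. Qed.

Lemma eq_lsum l a x y : {in l, forall i, x 0 i = y 0 i} -> lsum l a x = lsum l a y.
Proof. by move=> xy; apply: eq_big_seq => i il; rewrite xy. Qed.

Lemma eq_eul l x y x' y' : {in l, forall i, x 0 i = x' 0 i} ->
  {in l, forall i, y 0 i = y' 0 i} -> eul l x y = eul l x' y'.
Proof.
elim: l => //= a l IHl xx yy; rewrite xx ?yy ?mem_head //.
have xx' : {in l, forall i, x 0 i = x' 0 i}.
  by move=> i il; rewrite xx // inE il orbT.
rewrite (IHl xx'); last by move=> i il; rewrite yy // inE il orbT.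
by rewrite (eq_lsum _ xx').
Qed.

Lemma bf_supp l x a : uniq l -> supp l x -> bf x (sroot a) = lsum l a x.
Proof.
move=> ul sx; rewrite bf_srootr /lsum (big_uniq _ ul) /= [RHS]big_mkcond /=.
by apply: eq_bigr => i _; case: ifPn => // il; rewrite sx ?mul0r.
Qed.

Lemma supp_split a l x : supp (a :: l) x -> a \notin l ->
  exists x', [/\ supp l x', x = x 0 a *: sroot a + x' & {in l, forall i, x 0 i = x' 0 i}].
Proof.
move=> sx al; exists (x - x 0 a *: sroot a); split.
- move=> i il; rewrite !mxE eqxx /=; have [->|ia] := eqVneq i a; first by rewrite mulr1 subrr.
  by rewrite sx ?inE ?negb_or ?ia // mulr0 subr0.
- by rewrite addrC subrK.
- move=> i il; rewrite !mxE eqxx /=; have [ia|ia] := eqVneq i a.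
    by rewrite -ia il in al.
  by rewrite mulr0 subr0.
Qed.

Lemma eul_cons a l x y x' y' : uniq (a :: l) ->
  supp l x' -> {in l, forall i, x 0 i = x' 0 i} ->
  {in l, forall i, y 0 i = y' 0 i} ->
  eul (a :: l) x y = y 0 a * (x 0 a + bf x' (sroot a)) + eul l x' y'.
Proof.
move=> /andP[_ ul] sx xx yy /=; rewrite (bf_supp _ ul sx) (eq_lsum _ xx).
by rewrite (eq_eul xx yy).
Qed.

Lemma eul_sym l x y : uniq l -> supp l x -> supp l y ->
  eul l x y + eul l y x = bf x y.
Proof.
elim: l x y => [|a l IHl] x y.
  move=> _ sx _; have -> : x = 0 by apply/rowP => i; rewrite sx // mxE.
  by rewrite bf0l /= addr0.
move=> ual; have /andP[al ul] := ual => sx sy.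
have [x' [sx' xE xx]] := supp_split sx al.
have [y' [sy' yE yy]] := supp_split sy al.
rewrite (eul_cons ual sx' xx yy) (eul_cons ual sy' yy xx) xE yE.
rewrite !(bfDl, bfDr, bfZl, bfZr) -(IHl x' y') // bf_sroot cox_form_diag.
rewrite (bfC (sroot a) y') -!xE -!yE; ring.
Qed.

Lemma eul_rcons a l x y : eul (rcons l a) x y =
  eul l x y + x 0 a * (y 0 a + lsum l a y).
Proof.
elim: l => [|b l IHl] /=; first by rewrite /lsum !big_nil; ring.
rewrite IHl /lsum big_cons -cats1 big_cat big_seq1 /= (cox_formC R b a); ring.
Qed.

(** Conjugation by the first letter turns the Coxeter element of [a :: l] into that of [rcons l a],
    and carries the Euler form along. This lets every claim be moved to the moment when a given
    reflection is the first letter. *)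
Lemma eul_rot a l x y : uniq (a :: l) -> supp (a :: l) x -> supp (a :: l) y ->
  eul (rcons l a) (x *m simple_mx R a) (y *m simple_mx R a) = eul (a :: l) x y.
Proof.
move=> ual sx sy; have /andP[al ul] := ual.
have co z i : i \in l -> (z *m simple_mx R a) 0 i = z 0 i.
  move=> il; rewrite mul_simple_mx !mxE eqxx /=; have [ia|ia] := eqVneq i a.
    by rewrite -ia il in al.
  by rewrite mulr0 subr0.
have coa z : supp (a :: l) z ->
    (z *m simple_mx R a) 0 a = - (z 0 a + lsum l a z).
  move=> sz; rewrite mul_simple_mx !mxE !eqxx /= (bf_supp _ ual sz) /lsum big_cons.
  by rewrite cox_form_diag; ring.
rewrite eul_rcons (eq_eul (co x) (co y)) (eq_lsum _ (co y)) !coa //=; ring.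
Qed.

Lemma eul_sroot a l y : a \notin l -> eul (a :: l) (sroot a) y = y 0 a.
Proof.
move=> al; have z : {in l, forall i, sroot a 0 i = 0 :> R}.
  by move=> i il; rewrite mxE eqxx /=; case: eqP al => //= <-; rewrite il.
have z0 : {in l, forall i, sroot a 0 i = (0 : V) 0 i} by move=> i /z ->; rewrite mxE.
rewrite /= (eq_eul (y' := y) z0) // eul0l (eq_lsum _ z0) mxE !eqxx /lsum big1.
  by rewrite /= !addr0 mulr1.
by move=> i _; rewrite mxE mul0r.
Qed.

Variable rho : W -> 'M[R]_n.
Hypothesis rho1 : rho 1%g = 1%:M.
Hypothesis rhoM : forall w w', rho (w * w')%g = rho w *m rho w'.
Hypothesis rhoS : forall i, rho (simple i) = simple_mx R i.

Lemma supp_simple l x a : a \in l -> supp l x -> supp l (x *m simple_mx R a).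
Proof.
move=> al sx i il; rewrite mul_simple_mx !mxE eqxx /=.
have [ia|ia] := eqVneq i a; first by rewrite -ia (negPf il) in al.
by rewrite sx // mulr0 subr0.
Qed.

Lemma supp_diff l v : supp l (v - v *m rho (wprod l)).
Proof.
elim: l v => [|a l IHl] v i; first by rewrite wprod_nil rho1 mulmx1 subrr mxE.
rewrite inE negb_or => /andP[ia il]; have := IHl (v *m simple_mx R a) i il.
rewrite wprod_cons rhoM rhoS mulmxA mul_simple_mx !mxE eqxx (negPf ia) /=.
by rewrite mulr0 subr0.
Qed.

Lemma eul_diff l x y : uniq l -> supp l x ->
  eul l x (y - y *m rho (wprod l)) = bf x y.
Proof.
elim: l x y => [|a l IHl] x y.
  move=> _ sx; have -> : x = 0 by apply/rowP => i; rewrite sx // mxE.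
  by rewrite bf0l.
move=> ual sx; have /andP[al ul] := ual; have [x' [sx' xE xx]] := supp_split sx al.
set ys := y *m simple_mx R a; pose z := ys - ys *m rho (wprod l).
have zE : y - y *m rho (wprod (a :: l)) = bf y (sroot a) *: sroot a + z.
  rewrite wprod_cons rhoM rhoS mulmxA -/ys /z addrA; congr (_ - _).
  by rewrite /ys mul_simple_mx addrC subrK.
have sz : supp l z by apply: supp_diff.
rewrite zE (@eul_cons a l x _ x' z) //; last first.
  move=> i il; rewrite !mxE; have [ia|ia] := eqVneq i a.
    by rewrite -ia il in al.
  by rewrite eqxx /= mulr0 add0r.
rewrite [X in X * _]mxE (sz a al) IHl // !mxE !eqxx /ys mul_simple_mx bfBr bfZr.
by rewrite [in RHS]xE bfDl bfZl (bfC (sroot a)) /=; ring.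
Qed.

(** Letters after a leave the a-coordinate alone, so a fixed vector is orthogonal to the root of a,
    and is then fixed by the rest of the word. *)
Lemma fixed_peel l x : uniq l -> x *m rho (wprod l) = x ->
  {in l, forall i, bf x (sroot i) = 0}.
Proof.
elim: l x => [|a l IHl] x //= /andP[al ul].
rewrite wprod_cons rhoM rhoS mulmxA => fx.
have b0 : bf x (sroot a) = 0.
  have := supp_diff (x *m simple_mx R a) al; rewrite fx mul_simple_mx !mxE !eqxx.
  by rewrite /=; lra.
have xa : x *m simple_mx R a = x by rewrite mul_simple_mx b0 scale0r subr0.
rewrite xa in fx => i; rewrite inE => /predU1P[-> //|]; exact: IHl.
Qed.

(* The W-invariant positive definite form replaces the positivity of [bf]. *)
Definition avg x y : R := \sum_w \sum_i (x *m rho w) 0 i * (y *m rho w) 0 i.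

Lemma avg_act g x y : avg (x *m rho g) (y *m rho g) = avg x y.
Proof.
rewrite /avg [RHS](reindex_inj (mulgI g)) /=; apply: eq_bigr => w _.
by rewrite rhoM !mulmxA.
Qed.

Lemma avg_linear x : linear_for *%R (avg x).
Proof.
move=> k y z; rewrite /avg mulr_sumr -big_split /=; apply: eq_bigr => w _.
rewrite mulr_sumr -big_split /=; apply: eq_bigr => i _.
by rewrite mulmxDl -scalemxAl !mxE; ring.
Qed.
HB.instance Definition _ x :=
  GRing.isLinear.Build R V R *%R (avg x) (avg_linear x).

Lemma fixed_eq0 l x : uniq l -> supp l x -> x *m rho (wprod l) = x -> x = 0.
Proof.
move=> ul sx /(fixed_peel ul) b0.
(* s_i fixes x and negates its own root, so an invariant form makes them orthogonal. *)
have orth i : i \in l -> avg x (sroot i) = 0.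
  move=> il; have := avg_act (simple i) x (sroot i).
  rewrite rhoS !mul_simple_mx b0 // scale0r subr0 bf_sroot cox_form_diag.
  rewrite scalerDl scale1r opprD addrA subrr add0r linearN; lra.
have xx0 : avg x x = 0.
  rewrite {2}[x]row_sum_delta linear_sum big1 // => i _; rewrite linearZ /=.
  have [il|il] := boolP (i \in l); first by rewrite (orth i il) mulr0.
  by rewrite sx ?mul0r.
have sq_ge0 w : 0 <= \sum_i (x *m rho w) 0 i * (x *m rho w) 0 i.
  by apply: sumr_ge0 => i _; rewrite -expr2 sqr_ge0.
have /eqP := xx0; rewrite /avg psumr_eq0 => [|w _]; last exact: sq_ge0.
move=> /allP/(_ 1%g (mem_index_enum _)) /=; rewrite rho1 mulmx1 psumr_eq0.
  move=> /allP x0; apply/rowP => i; rewrite mxE; apply/eqP.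
  by have := x0 i (mem_index_enum _); rewrite /= mulf_eq0 orbb.
by move=> i _; rewrite -expr2 sqr_ge0.
Qed.

End EulerForm.

(** * Noncrossing pairs and the order on reflections *)

Section RootOrder.
Variables (R : realType) (W : finCoxeter).
Local Notation n := #|simple_refl W|.
Local Notation V := 'rV[R]_n.
Implicit Types (i j a : 'I_n) (w : W) (l : seq 'I_n) (x y z v : V) (t u : refl W).
Local Notation sroot := (@sroot R W).
Local Notation M := (cox_form R W).

Variable rho : W -> 'M[R]_n.
Hypothesis rho1 : rho 1%g = 1%:M.
Hypothesis rhoM : forall w w', rho (w * w')%g = rho w *m rho w'.
Hypothesis rhoS : forall i, rho (simple i) = simple_mx R i.
Variable rt : refl W -> V.
Hypothesis rtP : forall t, is_root_of rho t (rt t).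

Lemma rt_pos t : pos (rt t). Proof. by case: (rtP t). Qed.
Lemma rt_norm t : bf (rt t) (rt t) = 2. Proof. by case: (rtP t). Qed.
Lemma rt_act t v : v *m rho (val t) = v - bf v (rt t) *: rt t.
Proof. by case: (rtP t). Qed.

Lemma rt_neq0 t : rt t != 0.
Proof.
apply/eqP => t0; have := rt_norm t; rewrite t0 bf0l => /eqP.
by rewrite eq_sym pnatr_eq0.
Qed.

Lemma rt_inj : injective rt.
Proof.
move=> t u tu; apply/val_inj/(rho_inj rho1 rhoM rhoS); apply/row_matrixP => i.
by rewrite !rowE !rt_act tu.
Qed.

Lemma rt_conj t w :
  rt (rconjw t w) = rt t *m rho w \/ rt (rconjw t w) = - (rt t *m rho w).
Proof.
apply: (@root_pm _ _ rho (rconjw t w)); rewrite ?rt_norm //.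
- by rewrite (bf_rho rho1 rhoM rhoS) rt_norm.
- exact: rt_act.
move=> v; rewrite /= conjgE !rhoM !mulmxA rt_act mulmxBl (rhoVK rho1 rhoM).
rewrite -scalemxAl; congr (_ - _ *: _).
by rewrite -(bf_rho rho1 rhoM rhoS w) (rhoVK rho1 rhoM).
Qed.

Lemma rt_conj_pos t w : pos (rt t *m rho w) -> rt (rconjw t w) = rt t *m rho w.
Proof.
move=> p; case: (rt_conj t w) => // E; have := rt_pos (rconjw t w); rewrite E.
move=> pN; have x0 := pos_anti p pN.
by have := rt_neq0 (rconjw t w); rewrite E x0 oppr0 eqxx.
Qed.

Lemma rt_conj_colinear t w :
  exists2 e : R, e != 0 & rt (rconjw t w) = e *: (rt t *m rho w).
Proof.
case: (rt_conj t w) => ->; first by exists 1; rewrite ?oner_eq0 ?scale1r.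
by exists (- 1); rewrite ?oppr_eq0 ?oner_eq0 ?scaleN1r.
Qed.

Lemma simple_refl_in i : simple i \in reflections W.
Proof.
by apply/imset2P; exists (simple i) 1%g; rewrite ?simple_in ?inE ?conjg1.
Qed.

Definition srefl i : refl W := Refl (simple_refl_in i).

Lemma rt_srefl i : rt (srefl i) = sroot i.
Proof.
have ns : bf (sroot i) (sroot i) = 2 by rewrite bf_sroot cox_form_diag.
have [] := @root_pm _ _ rho (srefl i) _ _ (rt_norm (srefl i)) ns (rt_act (srefl i)) => //.
  by move=> v; rewrite /= rhoS mul_simple_mx.
move=> E; have := rt_pos (srefl i); rewrite E => pN.
by have := rt_neq0 (srefl i); rewrite E (pos_anti (pos_sroot R i) pN) oppr0 eqxx.
Qed.

(** A simple reflection changes a single coordinate, so a positive root that it makes negative is a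
    multiple of its own root, and the norm fixes the multiple. *)
Lemma rt_simple_pos t a : val t != simple a -> pos (rt t *m rho (simple a)).
Proof.
move=> ta; case: (rt_conj t (simple a)) => E; first by rewrite -E rt_pos.
exfalso; case/negP: ta; apply/eqP; suff -> : t = srefl a by [].
apply: rt_inj; rewrite rt_srefl.
have /posP pt := rt_pos t; have /posP pt' := rt_pos (rconjw t (simple a)).
have t0 i : i != a -> rt t 0 i = 0.
  move=> ia; apply/eqP; rewrite eq_le pt andbT.
  have := pt' i; rewrite E rhoS mul_simple_mx !mxE (negPf ia) /= mulr0 subr0.
  by rewrite oppr_ge0.
have tE : rt t = rt t 0 a *: sroot a.
  apply/rowP => i; rewrite !mxE eqxx /=; have [->|ia] := eqVneq i a.
    by rewrite mulr1.
  by rewrite t0 // mulr0.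
have := rt_norm t; rewrite tE bfZl bfZr bf_sroot cox_form_diag.
have := pt a; rewrite tE !mxE !eqxx /= mulr1; move: (rt t 0 a) => r r0 rr.
by have -> : r = 1; [nra | rewrite scale1r].
Qed.

Lemma rt_conj_simple t a : val t != simple a ->
  rt (rconjw t (simple a)) = rt t *m simple_mx R a.
Proof. by move=> /rt_simple_pos/rt_conj_pos; rewrite rhoS. Qed.

(* Conjugating by the letters of the periodic word l l l ..., [hits k l t]   *)
(* says that after k letters t has become the next letter. The first hitting *)
(* time orders the reflections.                                              *)
Fixpoint hits k l t : bool :=
  if l is a :: l' then
    if k is k'.+1 then hits k' (rcons l' a) (rconjw t (simple a))
    else val t == simple a
  else false.

(** The prefix product for the same clock as [hits]: it keeps a root positive until the hit
    ([nohit_pos]), and whole periods give powers of c ([rotpX]). *)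
Fixpoint rotp k l : W :=
  if l is a :: l' then
    if k is k'.+1 then (simple a * rotp k' (rcons l' a))%g else 1%g
  else 1%g.

Lemma rotp_cat l l' k :
  rotp (size l + k) (l ++ l') = (wprod l * rotp k (l' ++ l))%g.
Proof.
elim: l l' k => [|a l IHl] l' k; first by rewrite wprod_nil mul1g cats0.
by rewrite /= rcons_cat IHl wprod_cons mulgA cat_rcons.
Qed.

Lemma rotpX l m : rotp (m * size l) l = (wprod l ^+ m)%g.
Proof.
elim: m => [|m IHm]; first by case: l.
by have := rotp_cat l [::] (m * size l); rewrite cats0 IHm -expgS.
Qed.

Lemma nohit_pos k l t : (forall k', (k' < k)%N -> ~~ hits k' l t) ->
  pos (rt t *m rho (rotp k l)).
Proof.
elim: k l t => [|k IHk] [|a l] t nh; rewrite /= ?rho1 ?mulmx1 ?rt_pos //.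
have ta : val t != simple a by apply: (nh 0).
rewrite rhoM rhoS mulmxA -rt_conj_simple //; apply: IHk => k' lt.
exact: (nh k'.+1).
Qed.

Lemma supp_rho l l' x : {subset l' <= l} -> supp l x -> supp l (x *m rho (wprod l')).
Proof.
elim: l' x => [|a l' IHl] x sub sx; first by rewrite wprod_nil rho1 mulmx1.
rewrite wprod_cons rhoM rhoS mulmxA; apply: IHl.
  by move=> i il; apply: sub; rewrite inE il orbT.
by apply: supp_simple => //; apply: sub; rewrite mem_head.
Qed.

(* Otherwise the orbit of the root under the Coxeter element stays positive, *)
(* and its sum is a nonzero fixed vector.                                    *)
Lemma ex_hits l t : uniq l -> supp l (rt t) -> exists k, hits k l t.
Proof.
move=> ul st; apply: contrapT => nh.
have {}nh k : ~~ hits k l t by apply/negP => h; apply: nh; exists k.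
set c := wprod l.
have pc m : pos (rt t *m rho (c ^+ m)%g).
  by rewrite -rotpX; apply: nohit_pos.
pose z := \sum_(j < #[c]%g) rt t *m rho (c ^+ j)%g.
have sX m : supp l (rt t *m rho (c ^+ m)%g).
  elim: m => [|m IHm]; first by rewrite rho1 mulmx1.
  by rewrite expgSr rhoM mulmxA; apply: supp_rho.
have sz : supp l z.
  by move=> i il; rewrite summxE big1 // => j _; apply: sX.
have fz : z *m rho c = z.
  have := order_gt0 c; rewrite /z; have := expg_order c; case: #[c]%g => // m cm _.
  rewrite mulmx_suml big_ord_recr [RHS]big_ord_recl /= -mulmxA -rhoM -expgSr cm.
  rewrite addrC; congr (_ + _); apply: eq_bigr => j _.
  by rewrite -mulmxA -rhoM -expgSr.
have z0 := fixed_eq0 rho1 rhoM rhoS ul sz fz.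
have /eqP := rt_neq0 t; apply; apply/rowP => i; rewrite [RHS]mxE.
have /posP/(_ i) pt := rt_pos t; apply/eqP; rewrite eq_le pt andbT.
have : z 0 i = 0 by rewrite z0 mxE.
rewrite /z; have := order_gt0 c; case: #[c]%g => // m _.
rewrite big_ord_recl /= rho1 mulmx1 mxE summxE => zi.
have : 0 <= \sum_(j < m) (rt t *m rho (c ^+ bump 0 j)%g) 0 i.
  by apply: sumr_ge0 => j _; have /posP := pc (bump 0 j).
move: zi; move: (\sum_(j < m) _) (rt t 0 i) => p q; lra.
Qed.

Lemma hits_inj k l t u : hits k l t -> hits k l u -> t = u.
Proof.
elim: k l t u => [|k IHk] [|a l] t u //=.
  by move=> /eqP ta /eqP ua; apply/val_inj; rewrite /= ta ua.
move=> ht hu; have := IHk _ _ _ ht hu => /(congr1 val) /= /conjg_inj.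
exact: val_inj.
Qed.

Lemma rprod_conj ts w : rprod [seq rconjw t w | t <- ts] = (rprod ts ^ w)%g.
Proof.
elim: ts => [|t ts IH]; first by rewrite /rprod !big_nil conj1g.
by rewrite /rprod /= !big_cons conjMg -/(rprod ts) -IH.
Qed.

Lemma wprod_rot a l : wprod (rcons l a) = (wprod (a :: l) ^ simple a)%g.
Proof.
rewrite -cats1 wprod_cat !wprod_cons wprod_nil mulg1 conjgE simpleV.
by rewrite !mulgA simpleK mul1g.
Qed.

Lemma rprod_cons t ts : rprod (t :: ts) = (val t * rprod ts)%g.
Proof. exact: big_cons. Qed.

Lemma rprod_nil : rprod (W := W) [::] = 1%g.
Proof. exact: big_nil. Qed.

Lemma telescope ts v : v - v *m rho (rprod ts) =
  \sum_(k < size ts) bf (v *m rho (rprod (take k ts))) (rt (tnth (in_tuple ts) k))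
     *: rt (tnth (in_tuple ts) k).
Proof.
elim: ts v => [|t ts IHts] v.
  by rewrite big_ord0 rprod_nil rho1 mulmx1 subrr.
rewrite big_ord_recl /= rprod_nil rho1 mulmx1 (tnth_nth t) /=.
rewrite rprod_cons rhoM mulmxA.
have -> : v - v *m rho (val t) *m rho (rprod ts) = (v - v *m rho (val t)) +
  (v *m rho (val t) - v *m rho (val t) *m rho (rprod ts)).
  by rewrite addrA subrK.
rewrite IHts; congr (_ + _); first by rewrite rt_act opprB addrC subrK.
apply: eq_bigr => k _; rewrite !(tnth_nth t) /=.
by rewrite rprod_cons rhoM mulmxA.
Qed.

Definition full l := perm_eq l (enum 'I_n).

Lemma full_uniq l : full l -> uniq l.
Proof. by move=> /perm_uniq ->; rewrite enum_uniq. Qed.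

Lemma full_supp l x : full l -> supp l x.
Proof. by move=> /perm_mem lE i; rewrite lE mem_enum. Qed.

Lemma full_rot a l : full (a :: l) -> full (rcons l a).
Proof. by rewrite /full perm_rcons. Qed.

Lemma full_size l : full l -> size l = n.
Proof. by move=> /perm_size ->; rewrite size_enum_ord. Qed.

(** A Coxeter element fixes no nonzero vector, so 1 - c is invertible; by [telescope] it factors
    through the roots of [ts], which must therefore be n independent vectors. The pairings in the
    conclusion are the coordinates of v - vc in that basis. *)
Lemma coxeter_basis l ts : full l -> wprod l = rprod ts -> (size ts <= n)%N ->
  size ts = n /\ forall k : 'I_(size ts), exists2 v,
    v - v *m rho (wprod l) = rt (tnth (in_tuple ts) k) &
    forall k' : 'I_(size ts),
      bf (v *m rho (rprod (take k' ts))) (rt (tnth (in_tuple ts) k')) = (k' == k)%:R.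
Proof.
move=> fl cE szts; set c := wprod l; pose A := 1%:M - rho c.
have Av v : v *m A = v - v *m rho c by rewrite mulmxBr mulmx1.
have rkA : row_free A.
  rewrite -kermx_eq0; apply/eqP/row_matrixP => i; rewrite row0.
  apply: (fixed_eq0 rho1 rhoM rhoS (full_uniq fl) (full_supp _ fl)).
  apply/eqP; rewrite -subr_eq0 -oppr_eq0 opprB -Av -row_mul mulmx_ker.
  by apply/eqP; rewrite row0.
have uA : A \in unitmx by rewrite -row_free_unit.
pose T := \matrix_(k < size ts) rt (tnth (in_tuple ts) k).
pose d v := \row_(k < size ts)
  bf (v *m rho (rprod (take k ts))) (rt (tnth (in_tuple ts) k)).
have dT v : v *m A = d v *m T.
  rewrite Av /c cE telescope mulmx_sum_row; apply: eq_bigr => k _.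
  by rewrite mxE rowK.
have AT : A = (\matrix_i d (row i 1%:M)) *m T.
  by apply/row_matrixP => i; rewrite row_mul rowK -dT -row_mul mul1mx.
have rkT : (n <= \rank T)%N.
  have rA : (n <= \rank A)%N by rewrite (eqP rkA).
  by apply: leq_trans rA _; rewrite {1}AT mxrankM_maxr.
have szE : size ts = n.
  by apply/eqP; rewrite eqn_leq szts (leq_trans rkT) ?rank_leq_row.
have fT : row_free T by rewrite /row_free eqn_leq rank_leq_row /= (leq_trans szts).
(* [v] is the preimage of the k-th root under 1 - c, so its coordinates form the k-th unit
   vector. *)
split=> // k; pose v := rt (tnth (in_tuple ts) k) *m invmx A.
have vE : v *m A = rt (tnth (in_tuple ts) k) by rewrite mulmxKV.
exists v; first by rewrite -Av.
move=> k'; have : d v *m T = delta_mx 0 k *m T by rewrite -dT vE -rowE rowK.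
by move=> /(row_free_inj fT) /rowP/(_ k'); rewrite !mxE eqxx.
Qed.

(* Provable from [t * u <=_T c] and stable under rotation of the word l. *)
Definition fact l t u := exists2 rs, wprod l = rprod (t :: u :: rs) & ((size rs).+2 <= n)%N.

Lemma act_pair t u v : v - v *m rho (val t * val u)%g =
  bf v (rt t) *: rt t + bf (v *m rho (val t)) (rt u) *: rt u.
Proof.
rewrite rhoM mulmxA (rt_act u) opprB addrCA addrC; congr (_ + _).
by rewrite rt_act opprB addrC subrK.
Qed.

(** If v - vc is the root of u, then [eul_diff] turns E(t,u) into B(t,v), the first coordinate of v
    - vc, which is 0. The other two claims place both roots in the image of 1 - tu. *)
Lemma fact_pair l t u : full l -> fact l t u ->
  [/\ eul l (rt t) (rt u) = 0,
      exists v, v - v *m rho (val t * val u)%g = rt t &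
      exists v, v - v *m rho (val t * val u)%g = rt u].
Proof.
move=> fl [rs cE szrs]; have [szE basis] := coxeter_basis fl cE szrs.
pose k0 : 'I_(size (t :: u :: rs)) := Ordinal (isT : 0 < (size rs).+2)%N.
pose k1 : 'I_(size (t :: u :: rs)) := Ordinal (isT : 1 < (size rs).+2)%N.
have [v0 _ v0E] := basis k0; have [v1 v1c v1E] := basis k1.
have := v0E k0; have := v0E k1; have := v1E k0; have := v1E k1.
move: v1c; rewrite !(tnth_nth t) /= ?take0 rprod_cons rprod_nil mulg1 rho1 !mulmx1.
move=> v1c v11 v10 v01 v00; split.
- by rewrite -v1c (eul_diff rho1 rhoM rhoS _ (full_uniq fl) (full_supp _ fl)) bfC v10.
- by exists v0; rewrite act_pair v00 v01 scale0r scale1r addr0.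
- by exists v1; rewrite act_pair v10 v11 scale0r scale1r add0r.
Qed.

(** The image of 1 - tu depends only on the product, contains the roots of t' and u', and lies in
    the span of those of t and u. *)
Lemma fact_span l t u t' u' : full l -> fact l t' u' ->
  (val t * val u = val t' * val u')%g ->
  (exists p q, rt t' = p *: rt t + q *: rt u) /\
  (exists p q, rt u' = p *: rt t + q *: rt u).
Proof.
move=> fl f' E; have [_ [v vE] [v' v'E]] := fact_pair fl f'.
rewrite -vE -v'E -E !act_pair; split.
  by exists (bf v (rt t)), (bf (v *m rho (val t)) (rt u)).
by exists (bf v' (rt t)), (bf (v' *m rho (val t)) (rt u)).
Qed.

Lemma fact_rot a l t u : fact (a :: l) t u ->
  fact (rcons l a) (rconjw t (simple a)) (rconjw u (simple a)).
Proof.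
move=> [rs cE sz]; exists [seq rconjw r (simple a) | r <- rs]; last by rewrite size_map.
by rewrite wprod_rot cE -rprod_conj.
Qed.

Lemma eul_norm l t : full l -> eul l (rt t) (rt t) = 1.
Proof.
move=> fl; have := eul_sym (full_uniq fl) (full_supp (rt t) fl) (full_supp (rt t) fl).
by rewrite rt_norm; lra.
Qed.

(** Pairing with the first simple root under E reads off the a-coordinate, so the root of u has
    none; off-diagonal entries of the Coxeter form are nonpositive. *)
Lemma initial_le0 a l t u : full (a :: l) -> val t = simple a ->
  fact (a :: l) t u -> bf (rt t) (rt u) <= 0 /\ rt u 0 a = 0.
Proof.
move=> fl ta f; have tE : t = srefl a by apply: val_inj.
have [E _ _] := fact_pair fl f; have /andP[al _] := full_uniq fl.
move: E; rewrite tE rt_srefl eul_sroot // => ua; split => //.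
rewrite bfC bf_srootr; apply: sumr_le0 => j _.
have [->|ja] := eqVneq j a; first by rewrite ua mul0r.
by rewrite mulr_ge0_le0 ?cox_form_le0 //; have /posP := rt_pos u.
Qed.

(** Rotate until t is the first letter: up to then neither root has changed sign, so their pairing
    is preserved. *)
Lemma ascent_le0 k l t u : full l -> fact l t u -> hits k l t ->
  (forall k', (k' < k)%N -> ~~ hits k' l t) ->
  (forall k', (k' < k)%N -> ~~ hits k' l u) -> bf (rt t) (rt u) <= 0.
Proof.
elim: k l t u => [|k IHk] [|a l] t u //= fl f ht nt nu.
  by have [] := initial_le0 fl (eqP ht) f.
have ta : val t != simple a by apply: (nt 0).
have ua : val u != simple a by apply: (nu 0).
have := IHk _ _ _ (full_rot fl) (fact_rot f) ht.
rewrite !rt_conj_simple // bf_simple_mx; apply=> k' lt.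
  exact: (nt k'.+1).
exact: (nu k'.+1).
Qed.

(** On the roots x, y of t, u the matrix of E has rows (1,0) and (b,1) with b <= 0. Write x' = px +
    qy and y' = p'x + q'y with nonnegative coefficients. If p and q are both positive, then b = 0
    forces y' = 0, while b < 0 forces pq' - p'q > 0, although q(pq' - p'q) = -p' <= 0. *)
Lemma initial_unique a l t u t' u' : full (a :: l) -> val t = simple a ->
  fact (a :: l) t u -> fact (a :: l) t' u' ->
  (val t * val u = val t' * val u')%g -> bf (rt t') (rt u') <= 0 ->
  t' = t \/ (t' = u /\ u' = t).
Proof.
move=> fl ta f f' tuE le'; have [b0 ua] := initial_le0 fl ta f.
have [[p [q x'E]] [p' [q' y'E]]] := fact_span fl f' tuE.
have tE : t = srefl a by apply: val_inj.
have xE : rt t = sroot a by rewrite tE rt_srefl.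
have [Exy _ _] := fact_pair fl f; have [Exy' _ _] := fact_pair fl f'.
have Exx := eul_norm t fl; have Eyy := eul_norm u fl.
have Exx' := eul_norm t' fl; have Eyy' := eul_norm u' fl.
have Eyx : eul (a :: l) (rt u) (rt t) = bf (rt t) (rt u).
  have := eul_sym (full_uniq fl) (full_supp (rt t) fl) (full_supp (rt u) fl).
  by rewrite Exy add0r.
have Eyx' : eul (a :: l) (rt u') (rt t') = bf (rt t') (rt u').
  have := eul_sym (full_uniq fl) (full_supp (rt t') fl) (full_supp (rt u') fl).
  by rewrite Exy' add0r.
(* The a-coordinate of a positive root in the plane is [r]; any other coordinate where the root of u
   is nonzero gives the sign of [s]. *)
have coef (r s : R) (z : refl W) : rt z = r *: rt t + s *: rt u -> 0 <= r /\ 0 <= s.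
  move=> zE; have /posP pz := rt_pos z; have /posP pu := rt_pos u; split.
    by have := pz a; rewrite zE xE !mxE !eqxx /= ua mulr0 addr0 mulr1.
  rewrite leNgt; apply/negP => s0; have /eqP := rt_neq0 u; apply.
  apply/rowP => i; rewrite [RHS]mxE; have [->//|ia] := eqVneq i a.
  have := pz i; rewrite zE xE !mxE (negPf ia) andbF mulr0 add0r.
  have := pu i; move: (rt u 0 i) => r0 r00 r01; nra.
have [p0 q0] := coef _ _ _ x'E; have [p0' q0'] := coef _ _ _ y'E.
move: Exx' Eyy' Exy' Eyx'.
set B' := bf (rt t') (rt u') in le' *.
rewrite x'E y'E !(eulDl, eulDr, eulZl, eulZr) Exx Eyy Exy Eyx.
set b := bf (rt t) (rt u) in b0 *.
move=> Exx' Eyy' Exy' Eyx'.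
have [q_0|qn0] := eqVneq q 0.
  left; apply: rt_inj; rewrite x'E q_0 scale0r addr0.
  by have -> : p = 1; [move: Exx'; rewrite q_0; nra | rewrite scale1r].
have qp : 0 < q by rewrite lt_neqAle eq_sym qn0.
have [p_0|pn0] := eqVneq p 0; [right|exfalso].
  have q1 : q = 1 by move: Exx'; rewrite p_0; nra.
  rewrite p_0 q1 in Exy' Eyx' x'E.
  suff [p1 q_0'] : p' = 1 /\ q' = 0.
    split; apply: rt_inj; first by rewrite x'E scale0r add0r scale1r.
    by rewrite y'E p1 q_0' scale1r scale0r addr0.
  have le0 : q' <= 0 by nra.
  have q0'' : q' = 0 by lra.
  by split => //; move: Eyy'; rewrite q0''; nra.
have pp : 0 < p by rewrite lt_neqAle eq_sym pn0.
(* [e1] is E(x',y') = 0, [e2] is E(y',x') = B(x',y') <= 0, and [e3], [e4] are the norms. *)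
have e1 : p * p' + q * q' + b * (q * p') = 0 by lra.
have e2 : p * p' + q * q' + b * (p * q') <= 0 by lra.
have e3 : p ^+ 2 + q ^+ 2 + b * (p * q) = 1 by rewrite -Exx'; ring.
have e4 : p' ^+ 2 + q' ^+ 2 + b * (p' * q') = 1 by rewrite -Eyy'; ring.
have e5 : p' * q = p * q' -> False.
  move=> E.
  have p'0 : p' = 0.
    rewrite -[p']mulr1 -e3.
    have -> : p' * (p ^+ 2 + q ^+ 2 + b * (p * q)) =
      p * (p * p' + q * q' + b * (q * p')) + q * (p' * q - p * q') by ring.
    by rewrite e1 E subrr !mulr0 addr0.
  have /eqP : p * q' = 0 by rewrite -E p'0 mul0r.
  by rewrite mulf_eq0 (negPf pn0) => /eqP q'0; move: e4; rewrite p'0 q'0; lra.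
have e6 : b * (p * q' - p' * q) <= 0 by nra.
have [bE|bn0] := eqVneq b 0.
  rewrite bE in e1; have /eqP : p * p' = 0 by nra.
  rewrite mulf_eq0 (negPf pn0) => /eqP p'0; have /eqP : q * q' = 0 by nra.
  by rewrite mulf_eq0 (negPf qn0) => /eqP q'0; apply: e5; rewrite p'0 q'0; ring.
have bn : b < 0 by rewrite lt_neqAle bn0.
have e7 : p' * q < p * q'.
  rewrite lt_neqAle; apply/andP; split; first by apply/eqP.
  by rewrite -subr_ge0; rewrite nmulr_rle0 in e6.
have e8 : q * (p * q' - p' * q) > 0 by rewrite mulr_gt0 // subr_gt0.
have e9 : q * (p * q' - p' * q) = - p'.
  have -> : q * (p * q' - p' * q) =
    p * (p * p' + q * q' + b * (q * p')) - p' * (p ^+ 2 + q ^+ 2 + b * (p * q)) by ring.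
  by rewrite e1 e3 mulr0 mulr1 add0r.
by move: e8; rewrite e9; lra.
Qed.

Lemma ascent_unique k l t u t' u' : full l -> fact l t u -> fact l t' u' ->
  (val t * val u = val t' * val u')%g -> hits k l t ->
  (forall r k', r \in [:: t; u; t'; u'] -> (k' < k)%N -> ~~ hits k' l r) ->
  bf (rt t') (rt u') <= 0 -> t' = t \/ (t' = u /\ u' = t).
Proof.
elim: k l t u t' u' => [|k IHk] [|a l] t u t' u' //= fl f f' E ht nh le'.
  exact: initial_unique fl (eqP ht) f f' E le'.
have na r : r \in [:: t; u; t'; u'] -> val r != simple a.
  by move=> rin; apply: (nh r 0).
have inj r r' : rconjw r (simple a) = rconjw r' (simple a) -> r = r'.
  by move=> /(congr1 val)/conjg_inj/val_inj.
have := IHk _ _ _ _ _ (full_rot fl) (fact_rot f) (fact_rot f') _ ht.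
rewrite /= -!conjMg E => /(_ erefl) => H.
have {H} [] := H.
- move=> r k'; rewrite -[[:: _; _; _; _]]/(map (fun r => rconjw r (simple a)) [:: t; u; t'; u']).
  move=> /mapP[r' rin ->] lt.
  exact: (nh r' k'.+1 rin).
- by rewrite !rt_conj_simple ?bf_simple_mx //; apply: na; rewrite !inE eqxx ?orbT.
- by move=> /inj; left.
- by move=> [/inj ? /inj ?]; right.
Qed.

(* Rotate until the first reflection is the first letter a; triangularity    *)
(* then kills the a-coordinate of the other roots, and a can be dropped.     *)
Lemma complete_factorization l ts : uniq l ->
  {in ts, forall t, supp l (rt t)} ->
  pairwise (fun t u => eul l (rt t) (rt u) == 0) ts ->
  exists2 rs, size (ts ++ rs) = size l & wprod l = rprod (ts ++ rs).
Proof.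
have [N] := ubnP (size l); elim: N l ts => // N IHN l ts szl.
case: ts => [|t ts] ul sts.
  move=> _; exists [seq srefl i | i <- l]; first by rewrite size_map.
  by rewrite /wprod /rprod big_map.
have [k ht] := ex_hits ul (sts t (mem_head _ _)).
elim: k l t ts ht szl ul sts => [|k IHk] [|a l] t ts // ht szl ual sts;
  rewrite pairwise_cons => /andP[pt pts]; have /andP[al ul] := ual.
  have tE : t = srefl a by apply: val_inj; apply/eqP.
  have u0 u : u \in ts -> rt u 0 a = 0.
    by move=> /(allP pt) /eqP; rewrite tE rt_srefl eul_sroot.
  have [||||rs szrs cE] := IHN l ts _ _ _ _ => //.
  - move=> u uin i il; have [->|ia] := eqVneq i a; first exact: u0.
    by apply: sts; rewrite ?inE ?negb_or ?uin ?orbT ?ia.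
  - apply: (@sub_in_pairwise _ [in ts] _ _ _ ts) pts; last exact/allP.
    by move=> u u' /u0 ua /u0 u'a; rewrite /= u'a mul0r add0r.
  exists rs; first by rewrite /= szrs.
  by rewrite wprod_cons cE /rprod /= big_cons tE.
have [||||rs szrs cE] := IHk (rcons l a) (rconjw t (simple a))
   [seq rconjw u (simple a) | u <- ts] ht.
- by rewrite size_rcons.
- by rewrite rcons_uniq al.
- move=> u; rewrite -[_ :: _]/(map (fun r => rconjw r (simple a)) (t :: ts)).
  move=> /mapP[u' uin ->]; have [e _ ->] := rt_conj_colinear u' (simple a).
  rewrite rhoS => i; rewrite mem_rcons mxE => il.
  by rewrite (supp_simple (mem_head a l) (sts _ uin)) // mulr0.
- have rot u u' : u \in t :: ts -> u' \in t :: ts ->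
    eul (a :: l) (rt u) (rt u') == 0 ->
    eul (rcons l a) (rt (rconjw u (simple a))) (rt (rconjw u' (simple a))) == 0.
    move=> uin uin' /eqP E; have [e _ ->] := rt_conj_colinear u (simple a).
    have [e' _ ->] := rt_conj_colinear u' (simple a).
    rewrite !rhoS eulZl eulZr eul_rot //; [|exact: sts|exact: sts].
    by rewrite E !mulr0.
  rewrite -[_ :: _]/(map (fun r => rconjw r (simple a)) (t :: ts)) pairwise_map.
  apply: (@sub_in_pairwise _ [in t :: ts]
    (fun u u' => eul (a :: l) (rt u) (rt u') == 0) _ _ (t :: ts)); last first.
  + by rewrite pairwise_cons; apply/andP; split.
  + exact/allP.
  + by move=> u u' uin uin'; apply: rot.
exists [seq rconjw r (simple a) | r <- rs].
  by move: szrs; rewrite /= !size_cat !size_map size_rcons.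
have : wprod (a :: l) = (wprod (rcons l a) ^ simple a)%g.
  by rewrite wprod_rot -conjgM simpleK conjg1.
rewrite cE -rprod_conj /= map_cat -map_comp => ->; congr (rprod _).
have KK u : rconjw (rconjw u (simple a)) (simple a) = u.
  by apply: val_inj; rewrite /= -conjgM simpleK conjg1.
by rewrite KK; congr (_ :: _ ++ _); rewrite -[RHS]map_id; apply: eq_map => u /=; rewrite KK.
Qed.

End RootOrder.

(** * Order and orthogonality of reflections for the given Coxeter element *)

Section NCGeometry.
Variables (W : finCoxeter) (c : W).
Hypothesis hc : standard_coxeter_elt c.
Implicit Types (t u : refl W).

Lemma ex_full_word : exists2 l : seq 'I_#|simple_refl W|, full l & c = wprod l.
Proof.
have [s ps ->] := hc; case: (posnP #|simple_refl W|) => [n0|n_gt0].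
  exists [::]; last first.
    have /size0nil -> : size s = 0 by rewrite (perm_size ps) -cardE.
    by rewrite wprod_nil big_nil.
  by rewrite /full perm_sym; apply/perm_nilP/size0nil; rewrite size_enum_ord.
have /card_gt0P[s0 Ss0] := n_gt0.
have sS x : x \in s -> x \in simple_refl W by rewrite (perm_mem ps) mem_enum.
pose r := enum_rank_in Ss0; exists [seq r x | x <- s].
  apply: uniq_perm; rewrite ?enum_uniq //.
    rewrite map_inj_in_uniq ?(perm_uniq ps) ?enum_uniq // => x y /sS Sx /sS Sy E.
    by rewrite -(enum_rankK_in Ss0 Sx) -/r E enum_rankK_in.
  move=> i; rewrite mem_enum inE; apply/mapP; exists (enum_val i).
    by rewrite (perm_mem ps) mem_enum enum_valP.
  by rewrite /r enum_valK_in.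
rewrite /wprod big_map; apply: eq_big_seq => x /sS Sx.
by rewrite /simple enum_rankK_in.
Qed.

(** The sign character: the universal property sends every simple reflection to the transposition of
    [bool]. *)
Lemma odd_refl : exists2 sgn : W -> bool,
  (forall w w', sgn (w * w')%g = sgn w (+) sgn w') & forall t, sgn (val t).
Proof.
have [_ _ univ] := finCoxeterP W.
pose f (w : W) : {perm bool} := tperm false true.
have [s t _ _|phi phiM phiE] := univ _ f; first by rewrite tperm2 expg1n.
exists (fun w => odd_perm (phi w)) => [w w'|t]; first by rewrite phiM odd_permM.
have /imset2P[s w Ss _ ->] := valP t.
have phi1 : phi 1%g = 1%g.
  by apply: (@mulgI _ (phi 1%g)); rewrite -phiM !mulg1.
have phiV : phi w^-1%g = (phi w)^-1%g.
  by apply: (@mulIg _ (phi w)); rewrite -phiM !mulVg.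
rewrite conjgE !phiM phiV -conjgE odd_permJ phiE // odd_tperm //.
Qed.

Lemma refl_invol t : (val t * val t = 1)%g.
Proof.
have [_ ord2 _] := finCoxeterP W; have /imset2P[s w /ord2 Ss _ ->] := valP t.
have ss1 : (s * s = 1)%g by have := expg_order s; rewrite Ss expgS expg1.
by rewrite -conjMg ss1 conj1g.
Qed.

(** Distinctness rules out length 0, and parity rules out length 1. *)
Lemma rlen_pair t u : t != u -> rlen (val t * val u)%g = 2.
Proof.
move=> tu; have := rlen_le [:: t; u].
rewrite rprod_cons rprod_cons rprod_nil mulg1.
have [sgn sgnM sgnT] := odd_refl.
have [ts sz E] := rlen_factor (val t * val u)%g; rewrite -sz.
case: ts sz E => [|r [|r' [|? ?]]] //= _.
  rewrite rprod_nil => tu1; case/eqP: tu; apply: val_inj.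
  by apply: (mulgI (val t)); rewrite -tu1 refl_invol.
rewrite rprod_cons rprod_nil mulg1 => /(congr1 sgn).
by rewrite sgnM !sgnT.
Qed.

(* [e t u] is the vanishing of the Euler form on the roots of t and u. *)
Lemma NC_geometry : exists (N : refl W -> nat) (e : rel (refl W)),
  [/\ injective N,
      forall t u t' u', (val t * val u)%g \in NC c 2 ->
        (val t * val u = val t' * val u')%g ->
        (N t < N u)%N -> (N t' < N u')%N -> t = t',
      forall t u, (val t * val u)%g \in NC c 2 -> e t u,
      forall t u t' u' r, (val t * val u)%g \in NC c 2 ->
        (val t * val u = val t' * val u')%g -> ~~ e t r -> e u r ->
        u' != u -> ~~ e u' r
    & forall ts, pairwise e ts -> rprod ts \in NC c (size ts)].
Proof.
pose R : realType := Rdefinitions.R.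
have [rho [rho1 rhoM rhoS]] := geometric_rep R W.
have [rt rtP] := choice (ex_root rho1 rhoM rhoS).
have [l fl cE] := ex_full_word.
have exN t : exists k, hits k l t.
  exact: (ex_hits rho1 rhoM rhoS rtP (full_uniq fl) (full_supp _ fl)).
pose N t := ex_minn (exN t).
have NP t : hits (N t) l t by rewrite /N; case: ex_minnP.
have Nlt t k : (k < N t)%N -> ~~ hits k l t.
  by rewrite /N; case: ex_minnP => m _ min km; apply/negP => /min; rewrite leqNgt km.
have rlen_c_le : (rlen c <= #|simple_refl W|)%N.
  have -> : c = rprod [seq srefl i | i <- l].
    by rewrite cE /rprod big_map.
  by apply: leq_trans (rlen_le _) _; rewrite size_map full_size.
have NCfact t u : (val t * val u)%g \in NC c 2 -> fact l t u.
  rewrite inE => /andP[/eqP le /eqP l2].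
  have [rs szrs rsE] := rlen_factor ((val t * val u)^-1 * c)%g.
  exists rs; first by rewrite !rprod_cons rsE mulgA mulKVg.
  by rewrite szrs -add2n -l2 le.
have rlen_c : rlen c = #|simple_refl W|.
  have [ts sz E] := rlen_factor c; rewrite -sz.
  have [] := coxeter_basis rho1 rhoM rhoS rtP (ts := ts) fl => //.
    by rewrite E cE.
  by rewrite sz.
exists N, (fun t u => eul l (rt t) (rt u) == 0); split.
- by move=> t u E; apply: (hits_inj (NP t)); rewrite E NP.
- move=> t u t' u'.
  (* By symmetry t may be assumed to be hit no later than the other three reflections, as the
     rotation in [ascent_unique] requires. *)
  wlog le : t u t' u' / (N t <= N t')%N.
    move=> H; case: (leqP (N t) (N t')) => [|/ltnW] le; first exact: H.
    by move=> nc E lt lt'; apply/esym; apply: H (esym E) lt' lt; rewrite // -E.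
  move=> nc E lt lt'.
  have f := NCfact _ _ nc; have f' : fact l t' u' by apply: NCfact; rewrite -E.
  have le0 : bf (rt t') (rt u') <= 0.
    apply: (ascent_le0 rho1 rhoM rhoS rtP fl f' (NP t')) => k' kk'.
      exact: Nlt.
    by apply: Nlt; apply: ltn_trans lt'.
  have [] := ascent_unique rho1 rhoM rhoS rtP fl f f' E (NP t) _ le0.
  + move=> r k' rin kk'; apply: Nlt; apply: leq_trans kk' _.
    move: rin; rewrite !inE => /or4P[] /eqP -> //; first exact: ltnW.
    by rewrite (leq_trans le) // ltnW.
  + by [].
  + by move=> [t'u u't]; move: lt lt'; rewrite t'u u't => lt /(ltn_trans lt); rewrite ltnn.
- move=> t u /NCfact f.
  by have [-> _ _] := fact_pair rho1 rhoM rhoS rtP fl f.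
- move=> t u t' u' r nc E etr /eqP eur u'u.
  have f' : fact l t' u' by apply: NCfact; rewrite -E.
  (* Write the root of u' as p times that of t plus q times that of u: then E(u',r) = pE(t,r), and p
     = 0 would give u' = u. *)
  have [_ [p [q u'E]]] := fact_span rho1 rhoM rhoS rtP fl f' E.
  rewrite u'E eulDl !eulZl eur mulr0 addr0 mulf_eq0 negb_or etr andbT.
  apply: contra u'u => /eqP p0; apply/eqP/(rt_inj rho1 rhoM rhoS rtP).
  rewrite u'E p0 scale0r add0r.
  have := rt_norm rtP u'; rewrite u'E p0 scale0r add0r bfZl bfZr (rt_norm rtP) => qq.
  have q1 : (q - 1) * (q + 1) = 0 by lra.
  have /eqP := q1; rewrite mulf_eq0 => /orP[/eqP qe|/eqP qe].
    by have -> : q = 1; [lra | rewrite scale1r].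
  have qN : q = -1 by lra.
  have := rt_pos rtP u'; rewrite u'E p0 scale0r add0r qN scaleN1r => pN.
  by have := rt_neq0 rtP u; rewrite (pos_anti (rt_pos rtP u) pN) eqxx.
- move=> ts ets.
  (* The completed factorization of c has n = [rlen c] factors, so each of its segments has a
     noncrossing product. *)
  have [|rs sz rsE] := complete_factorization rho1 rhoM rhoS rtP (full_uniq fl) _ ets.
    by move=> t _; apply: full_supp.
  apply: (@NC_factor _ c [::] ts rs) => /=.
  by rewrite -rsE -cE sz (full_size fl) inE /rle mulVg rlen1 addn0 rlen_c !eqxx.
Qed.
End NCGeometry.

(** * Telescoping sums, linear spans and maps out of the tensor algebra *)

Lemma sum_telescope (I : finType) (V : zmodType) (P : pred I) (F : I -> V) (h : I -> I) :
  injective h -> (forall i, P (h i) = P i) -> \sum_(i | P i) (F i - F (h i)) = 0.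
Proof.
move=> inj_h Ph; rewrite sumrB; apply/eqP; rewrite subr_eq0 (reindex_inj inj_h).
by apply/eqP; apply: eq_bigl.
Qed.

Lemma linear_fun0 (k : fieldType) (V U : lmodType k) (f : V -> U) :
  linear f -> f 0 = 0.
Proof.
move=> fP; have := fP 1 0 0; rewrite !scale1r addr0 => /(congr1 (+%R^~ (- f 0))).
by rewrite subrr addrK => <-.
Qed.

Section LinearSpan.
Variables (k : fieldType) (V : lmodType k).
Implicit Types (G : V -> Prop) (x y : V).

Lemma span_in G x : G x -> lspan G x.
Proof.
by move=> Gx; rewrite -[x]addr0 -[x]scale1r; apply: lspan_cons => //; apply: lspan0.
Qed.

Lemma spanD G x y : lspan G x -> lspan G y -> lspan G (x + y).
Proof.
elim=> [|a g z Gg _ IH] Gy; first by rewrite add0r.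
by rewrite -addrA; apply: lspan_cons => //; apply: IH.
Qed.

Lemma spanZ G a x : lspan G x -> lspan G (a *: x).
Proof.
elim=> [|b g z Gg _ IH]; first by rewrite scaler0; apply: lspan0.
by rewrite scalerDr scalerA; apply: lspan_cons.
Qed.

End LinearSpan.

Section LinearSpanMaps.
Variables (k : fieldType) (V U : lmodType k).
Implicit Types (G : V -> Prop) (x : V) (f h : {linear V -> U}).

Lemma span_map f G (H : U -> Prop) x :
  (forall g, G g -> lspan H (f g)) -> lspan G x -> lspan H (f x).
Proof.
move=> GH; elim=> [|a g z Gg _ IH]; first by rewrite linear0; apply: lspan0.
by rewrite linearP; apply: spanD => //; apply/spanZ/GH.
Qed.

End LinearSpanMaps.

(* An abstract algebra with a basis of words keeps unification tractable. *)
Section WordHom.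
Variables (k : fieldType) (X : Type) (B : lalgType k) (w : seq X -> B).
Hypothesis w_ind : forall P : B -> Prop,
  P 0 -> (forall a s x, P x -> P (a *: w s + x)) -> forall x, P x.
Hypothesis w_cat : forall s s', w s * w s' = w (s ++ s').
Hypothesis w_lin : forall s, linear (fun x => w s * x).

Lemma word_hom_mul (A : algType k) (h : {linear B -> A}) (g : X -> A) :
  (forall s, h (w s) = \prod_(t <- s) g t) -> {morph h : x y / x * y}.
Proof.
move=> hw x y; elim/w_ind: x => [|a s x IHx]; first by rewrite mul0r linear0 mul0r.
rewrite mulrDl -scalerAl !linearP IHx mulrDl -scalerAl.
congr (_ *: _ + _) => {IHx x}.
elim/w_ind: y => [|b s' y IHy]; first by rewrite mulr0 linear0 mulr0.
rewrite w_lin !linearP IHy mulrDr -scalerAr.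
by congr (_ *: _ + _); rewrite w_cat !hw big_cat.
Qed.

End WordHom.

Section TensorHom.
Variables (k : fieldType) (X : choiceType).
Local Notation TX := (tensor k X).
Implicit Types (x y : TX) (s : seq X).

Lemma word_consM t s : word (t :: s) = word [:: t] * word s :> TX.
Proof. by rewrite wordM. Qed.

Lemma word_mul_linear s : linear (fun x : TX => word s * x).
Proof.
elim: s => [|t s IHs] a x y; first by rewrite word_nil !mul1r.
by rewrite word_consM -!mulrA IHs; apply: tcons_linear.
Qed.

Variables (A : algType k) (g : X -> A).
Definition thom (x : TX) : A := lext (fun s => \prod_(t <- s) g t) x.
HB.instance Definition _ :=
  GRing.isLinear.Build k TX A *:%R thom (lext_is_linear (fun s => \prod_(t <- s) g t)).

Lemma thomP a x y : thom (a *: x + y) = a *: thom x + thom y.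
Proof. exact: lext_is_linear. Qed.

Lemma thom_word s : thom (word s) = \prod_(t <- s) g t.
Proof. exact: lext_word. Qed.

Lemma thom_monoid : monoid_morphism thom.
Proof.
split; first by rewrite -word_nil thom_word big_nil.
apply: (@word_hom_mul k X TX word (@word_ind k X) (@wordM k X) word_mul_linear A thom g).
exact: thom_word.
Qed.
HB.instance Definition _ := GRing.isMonoidMorphism.Build TX A thom thom_monoid.
End TensorHom.

(** * The map from the quadratic dual *)

Section DualAlgebra.
Variables (k : fieldType) (W : finCoxeter) (c : W).
Local Notation T := (refl W).
Local Notation TX := (tensor k T).
Local Notation SA := (shuffle_alg k W).
Local Notation Q := (quad_ideal (quad_perp (dual_braid_rel (k := k) c))).
Implicit Types (t u r : T) (s : seq T) (x y z : TX).

Definition hurwitz (p : T * T) : T * T := (p.2, rconj p.1 p.2).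

Lemma hurwitz_inj : injective hurwitz.
Proof.
move=> [t u] [t' u'] [<-] /conjg_inj tt'; congr (_, _).
exact: val_inj.
Qed.

Lemma hurwitz_prod (p : T * T) :
  (val (hurwitz p).1 * val (hurwitz p).2 = val p.1 * val p.2)%g.
Proof. by rewrite /= conjgE mulKVg. Qed.

Lemma quad_perpP (f : {ffun T * T -> k^o}) :
  quad_perp (dual_braid_rel c) f <->
  forall p, rle (val p.1 * val p.2)%g c -> f p = f (hurwitz p).
Proof.
pose gen (t u : T) : {ffun T * T -> k^o} :=
  [ffun p => (p == (t, u))%:R - (p == (u, rconj t u))%:R].
have genE t u : \sum_p f p * gen t u p = f (t, u) - f (u, rconj t u).
  have pick q : \sum_p f p * (p == q)%:R = f q.
    rewrite (bigD1 q) //= eqxx mulr1 big1 ?addr0 // => p /negPf ->.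
    by rewrite mulr0.
  by rewrite -!pick -sumrB; apply: eq_bigr => p _; rewrite ffunE mulrBr.
split=> [pf [t u] /= le|inv r].
  have /pf : dual_braid_rel c (gen t u).
    by apply: span_in; exists t, u.
  by rewrite genE => /subr0_eq.
elim=> [|a h x [t [u [le ->]]] _ IH].
  by apply: big1 => p _; rewrite ffunE mulr0.
have -> : \sum_p f p * (a *: gen t u + x) p =
    a * (\sum_p f p * gen t u p) + \sum_p f p * x p.
  rewrite mulr_sumr -big_split /=; apply: eq_bigr => p _.
  by rewrite !ffunE mulrDr mulrCA.
by rewrite IH genE (inv (t, u)) //= subrr mulr0 addr0.
Qed.

Lemma quad_elt_in f : quad_perp (dual_braid_rel c) f -> quad_elt f \in Q.
Proof.
move=> pf; apply/asboolP; rewrite -[quad_elt f]mulr1 -[quad_elt f]mul1r -[X in ideal_gen _ X]addr0.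
by apply: ideal_gen_cons; [exists f | apply: ideal_gen0].
Qed.

Lemma Q_scale a x : x \in Q -> a *: x \in Q.
Proof. by move=> Qx; rewrite -[x]mul1r scalerAl; apply: idealMr. Qed.

(** The indicator of the pair (t,u) lies in R^⊥: if t = u the pair is fixed by the Hurwitz move, and
    otherwise tu has length 2 and so is not below c, which leaves that pair unconstrained. *)
Lemma word_bad t u : (val t * val u)%g \notin NC c 2 -> word [:: t; u] \in Q.
Proof.
move=> bad; pose f : {ffun T * T -> k^o} := [ffun p => (p == (t, u))%:R].
have -> : word [:: t; u] = quad_elt f.
  rewrite /quad_elt (bigD1 (t, u)) //= ffunE eqxx scale1r big1 ?addr0 //.
  by move=> p /negPf pE; rewrite ffunE pE scale0r.
apply: quad_elt_in; apply/quad_perpP => p le; rewrite !ffunE.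
have [tu|tu] := eqVneq t u.
  have [->|pE] := eqVneq p (t, u).
    suff -> : hurwitz (t, u) = (t, u) by rewrite eqxx.
    by rewrite tu /hurwitz /=; congr (_, _); apply: val_inj; rewrite /= conjgE mulKg.
  case: eqP => // hp; case/eqP: pE; apply: hurwitz_inj; rewrite hp.
  by rewrite tu /hurwitz /=; congr (_, _); apply: val_inj; rewrite /= conjgE mulKg.
have ne q : rle (val q.1 * val q.2)%g c -> (q == (t, u)) = false.
  move=> leq; apply/negP => /eqP qE; case/negP: bad; rewrite inE rlen_pair // eqxx andbT.
  by move: leq; rewrite qE.
by rewrite !ne // hurwitz_prod.
Qed.

(** The indicator of a fibre of the product map is Hurwitz-invariant. This is the relation that
    drives all rewriting. *)
Lemma sum_product_in w :
  \sum_(p | (val p.1 * val p.2 == w)%g) word [:: p.1; p.2] \in Q.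
Proof.
pose f : {ffun T * T -> k^o} := [ffun p => (val p.1 * val p.2 == w)%g%:R].
have -> : \sum_(p | (val p.1 * val p.2 == w)%g) word [:: p.1; p.2] = quad_elt f.
  rewrite /quad_elt big_mkcond; apply: eq_bigr => p _; rewrite ffunE.
  by case: ifP; rewrite ?scale1r ?scale0r.
by apply: quad_elt_in; apply/quad_perpP => p _; rewrite !ffunE hurwitz_prod.
Qed.

Local Notation evsh := (thom (@sh_gen k W)).
Local Notation evni := (thom (@nich_gen k W)).

Lemma val_evni x : val (evni x) = evsh x.
Proof.
elim/word_ind: x => [|a s x IHx]; first by rewrite !linear0.
have -> : val (evni (a *: word s + x)) =
    a *: (val (evni (word s)) : SA) + (val (evni x) : SA).
  by rewrite thomP linearP.
by rewrite IHx thomP !thom_word rmorph_prod.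
Qed.

Lemma evsh_cons t s : evsh (word (t :: s)) = sh_gen k t * evsh (word s).
Proof. by rewrite !thom_word big_cons. Qed.

Lemma sh_gen_word t s : sh_gen k t * (word s : SA) = star_word k (@rconj W) [:: t] s :> TX.
Proof. by rewrite sh_mulE /star !lext_word. Qed.

Lemma star_word1 t u s : star_word k (@rconj W) [:: t] (u :: s) =
  word (t :: u :: s) - tcons u (star_word k (@rconj W) [:: rconj t u] s).
Proof.
rewrite star_word_cons; congr (_ + _).
  by rewrite star_word_nil; apply: wordM.
by rewrite expr1; apply: scaleN1r.
Qed.

Lemma sh_gen2 t u : sh_gen k t * sh_gen k u = word [:: t; u] - word [:: u; rconj t u] :> TX.
Proof.
transitivity (star_word k (@rconj W) [:: t] [:: u]); first exact: sh_gen_word.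
rewrite star_word1; congr (_ - _); exact: tcons_word.
Qed.

Lemma word_in_Jc s : rprod s \notin NC c (size s) -> evni (word s) \in Jc c.
Proof.
move=> bad; apply/asboolP; apply: span_in; exists (rprod s), (size s); split => //.
by apply: span_in; exists s; split=> //; rewrite thom_word.
Qed.

Lemma evni_quad f : quad_perp (dual_braid_rel c) f -> evni (quad_elt f) \in Jc c.
Proof.
move=> /quad_perpP pf; rewrite /quad_elt.
rewrite (bigID (fun p : T * T => (val p.1 * val p.2)%g \in NC c 2)) /= linearD /=.
(* Over [NC c 2] the image is a sum of F(p) - F([hurwitz] p), which cancels after reindexing. *)
set z := \sum_(p | _ \in _) _; have -> : evni z = 0.
  apply: val_inj; rewrite val_evni rmorph0 /z linear_sum.
  have -> : \sum_(p | (val p.1 * val p.2)%g \in NC c 2) evsh (f p *: word [:: p.1; p.2]) =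
    \sum_(p | (val p.1 * val p.2)%g \in NC c 2)
       (f p *: word [:: p.1; p.2] - f (hurwitz p) *: word [:: (hurwitz p).1; (hurwitz p).2]) :> TX.
    apply: eq_bigr => p; rewrite inE => /andP[le _]; rewrite linearZ /= -(pf p le) -scalerBr.
    by congr (_ *: _); rewrite thom_word big_cons big_seq1 sh_gen2.
  apply: (@sum_telescope _ TX _ (fun p => f p *: word [:: p.1; p.2]) _ hurwitz_inj).
  by move=> p; rewrite hurwitz_prod.
rewrite add0r linear_sum; apply: rpred_sum => p bad; rewrite linearZ /=.
rewrite -[evni _]mul1r scalerAl; apply: idealMr.
by apply: word_in_Jc; rewrite rprod_cons rprod_cons rprod_nil mulg1.
Qed.

Lemma evni_Q x : x \in Q -> evni x \in Jc c.
Proof.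
move=> /asboolP; elim=> [|a b g z [f pf ->] _ IH]; first by rewrite linear0 rpred0.
rewrite linearD /= rpredD // !rmorphM /=.
by apply: tsidealMl; apply: idealMr; apply: evni_quad.
Qed.

Definition Psi (x : Palg k c) : Palg' k c := Pproj c (evni (tsrepr x)).

Lemma Psi_tspi x : Psi (tspi Q x) = Pproj c (evni x).
Proof.
apply/tspi_eqP; rewrite -linearB; apply: evni_Q.
by apply/tspi_eqP; rewrite tsreprK.
Qed.

Lemma Psi_linear : linear Psi.
Proof.
move=> a x y; rewrite -[x]tsreprK -[y]tsreprK -linearP !Psi_tspi.
by rewrite /Pproj !linearP.
Qed.
HB.instance Definition _ := GRing.isLinear.Build k (Palg k c) (Palg' k c) *:%R Psi Psi_linear.

Lemma Psi_monoid : monoid_morphism Psi.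
Proof.
split=> [|x y]; first by rewrite -(rmorph1 (tspi Q)) Psi_tspi /Pproj !rmorph1.
rewrite -[x]tsreprK -[y]tsreprK -rmorphM !Psi_tspi /Pproj.
by rewrite !rmorphM.
Qed.
HB.instance Definition _ := GRing.isMonoidMorphism.Build (Palg k c) (Palg' k c) Psi Psi_monoid.

Lemma Psi_word s :
  Psi (\prod_(t <- s) Pgen k c t) = Pproj c (\prod_(t <- s) nich_gen k t).
Proof.
have -> : \prod_(t <- s) Pgen k c t = tspi Q (word s).
  elim: s => [|t s IHs]; first by rewrite big_nil word_nil rmorph1.
  by rewrite big_cons IHs word_consM rmorphM.
by rewrite Psi_tspi thom_word.
Qed.

Lemma evni_surj (z : nichols k W) : exists x, evni x = z.
Proof.
suff [x xE] : exists x, evsh x = val z.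
  by exists x; apply: val_inj; rewrite val_evni.
have /asboolP := valP z; elim=> [_ [t ->]||a y y' _ [x <-] _ [x' <-]|y y' _ [x <-] _ [x' <-]].
- by exists (word [:: t]); rewrite thom_word big_seq1.
- by exists 1; rewrite rmorph1.
- by exists (a *: x + x'); rewrite linearP.
- by exists (x * x'); rewrite rmorphM.
Qed.

Lemma Psi_surj (y : Palg' k c) : exists x : Palg k c, Psi x = y.
Proof.
have [x xE] := evni_surj (tsrepr y); exists (tspi Q x).
by rewrite Psi_tspi xE; apply: tsreprK.
Qed.

Lemma Psi_inj : (forall x, evni x \in Jc c -> x \in Q) -> injective Psi.
Proof.
move=> ker x y; rewrite -[x]tsreprK -[y]tsreprK !Psi_tspi => /tspi_eqP.
by rewrite -linearB => /ker xy; apply/tspi_eqP.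
Qed.

End DualAlgebra.

Lemma sum_sandwich (B : nzRingType) (I : finType) (P : pred I) (F : I -> B) (a b : B) :
  a * (\sum_(i | P i) F i) * b = \sum_(i | P i) a * F i * b.
Proof. by rewrite mulr_sumr mulr_suml. Qed.

(** * Rewriting and independence *)

Section Reduction.
Variables (k : fieldType) (V : lmodType k) (Q : V -> Prop).
Hypothesis Q0 : Q 0.
Hypothesis QD : forall x y, Q x -> Q y -> Q (x + y).
Hypothesis QZ : forall a x, Q x -> Q (a *: x).
Implicit Types (G : V -> Prop) (x y : V).

Definition red G x := exists2 y, lspan G y & Q (x - y).

Lemma red_in G x : G x -> red G x.
Proof. by move=> Gx; exists x; [apply: span_in | rewrite subrr]. Qed.

Lemma red_Q G x : Q x -> red G x.
Proof. by move=> Qx; exists 0; [apply: lspan0 | rewrite subr0]. Qed.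

Lemma redD G x y : red G x -> red G y -> red G (x + y).
Proof.
move=> [x' Gx Qx] [y' Gy Qy]; exists (x' + y'); first exact: spanD.
by rewrite opprD addrACA; apply: QD.
Qed.

Lemma redZ G a x : red G x -> red G (a *: x).
Proof.
move=> [x' Gx Qx]; exists (a *: x'); first exact: spanZ.
by rewrite -scalerBr; apply: QZ.
Qed.

Lemma red_sum G (I : finType) (P : pred I) (F : I -> V) :
  (forall i, P i -> red G (F i)) -> red G (\sum_(i | P i) F i).
Proof.
by move=> GF; apply: big_ind GF; [apply: red_Q | move=> x y; apply: redD].
Qed.

(** A relation is solved for one of its terms: that term reduces as soon as all the others do. *)
Lemma red_pick G (I : finType) (P : pred I) (F : I -> V) i0 :
  Q (\sum_(i | P i) F i) -> P i0 ->
  (forall i, P i -> i != i0 -> red G (F i)) -> red G (F i0).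
Proof.
move=> QF Pi0 GF.
have -> : F i0 = \sum_(i | P i) F i + (- 1) *: \sum_(i | P i && (i != i0)) F i.
  by rewrite (bigD1 i0) //= scaleN1r addrK.
by apply: redD; [apply: red_Q | apply/redZ/red_sum => i /andP[]; apply: GF].
Qed.

Lemma red_trans G G' x : (forall g, G g -> red G' g) -> red G x -> red G' x.
Proof.
move=> GG [y Gy Qxy]; rewrite -[x](subrK y); apply: redD; first exact: red_Q.
elim: Gy => [|a g z /GG Gg _ IH]; first exact: red_Q.
by apply: redD => //; apply: redZ.
Qed.

Lemma red_map (f : {linear V -> V}) G G' x : (forall y, Q y -> Q (f y)) ->
  (forall g, G g -> red G' (f g)) -> red G x -> red G' (f x).
Proof.
move=> fQ GG [y Gy Qxy]; rewrite -[x](subrK y) linearD.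
apply: redD; first by apply/red_Q/fQ.
elim: Gy => [|a g z /GG Gg _ IH]; first by rewrite linear0; apply: red_Q.
by rewrite linearP; apply: redD => //; apply: redZ.
Qed.

Lemma red_false x : red (fun=> False) x -> Q x.
Proof.
move=> [y Gy]; have -> : y = 0 by elim: Gy => // ? ? ? [].
by rewrite subr0.
Qed.

End Reduction.

(* [der r] strips a leading letter [r]; it detects the largest letter of a      *)
(* decreasing word because that letter can only occur in front.                 *)
Section Independence.
Variables (k : fieldType) (X : eqType) (N : X -> nat) (V U : lmodType k).
Variables (w : seq X -> V) (pre : X -> V -> V) (ev : V -> U).
Variables (der m : X -> U -> U).
Hypothesis N_inj : injective N.
Hypothesis preP : forall t, linear (pre t).
Hypothesis pre_w : forall t s, pre t (w s) = w (t :: s).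
Hypothesis evP : linear ev.
Hypothesis derP : forall t, linear (der t).
Hypothesis ev_pre : forall t y, ev (pre t y) = m t (ev y).
Hypothesis der_nil : forall t, der t (ev (w [::])) = 0.
Hypothesis der_neq : forall t u z, u != t -> der t z = 0 -> der t (m u z) = 0.
Hypothesis der_eq : forall t z, der t z = 0 -> der t (m t z) = z.
Hypothesis ev_nil : forall a, ev (a *: w [::]) = 0 -> a *: w [::] = 0.

Definition decreasing (s : seq X) := sorted (fun t u => N u < N t)%N s.

Let dec_below M y := exists s,
  [/\ decreasing s, all (fun t => N t < M)%N s & y = w s].

Lemma der_below t z : lspan (dec_below (N t)) z -> der t (ev z) = 0.
Proof.
elim=> [|a g y [s [_ sM ->]] _ IH]; first by rewrite (linear_fun0 evP) (linear_fun0 (derP t)).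
rewrite evP derP IH addr0; suff -> : der t (ev (w s)) = 0 by rewrite scaler0.
elim: s sM => [|u s IHs] //= /andP[ut sM]; rewrite -pre_w ev_pre der_neq ?IHs //.
by apply: contraTneq ut => ->; rewrite ltnn.
Qed.

(** Induction on the bound M: if t has rank M and y = y0 + t y1 with only smaller letters in y0 and
    y1, then [der t] sends ev y to ev y1. So y1 = 0, and then y0 = 0. *)
Lemma decreasing_free M y : lspan (dec_below M) y -> ev y = 0 -> y = 0.
Proof.
elim: M y => [|M IHM] y.
  move=> By; have [a ->] : exists a, y = a *: w [::].
    elim: By => [|a g z [[|? ?] [_ // _ ->]] _ [b ->]]; first by exists 0; rewrite scale0r.
    by exists (a + b); rewrite scalerDl.
  exact: ev_nil.
have [[t Nt]|noM] := pselect (exists t, N t = M); last first.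
  move=> By; apply: IHM; elim: By => [|a g z [s [ds sM ->]] _ IH]; first exact: lspan0.
  apply: lspan_cons => //; exists s; split => //; apply: sub_all sM => u.
  by rewrite ltnS leq_eqVlt => /predU1P[uM|//]; case: noM; exists u.
(* [y1] collects the tails of the words starting with [t]; in a decreasing word [t] cannot occur
   again. *)
move=> By; have [y0 [y1 [By0 By1 ->]]] : exists y0 y1,
    [/\ lspan (dec_below M) y0, lspan (dec_below M) y1 & y = y0 + pre t y1].
  elim: By => [|a g z [s [ds sM ->]] _ [z0 [z1 [Bz0 Bz1 ->]]]].
    by exists 0, 0; rewrite (linear_fun0 (preP t)) addr0; split=> //; apply: lspan0.
  case: s ds sM => [|u s] ds sM.
    exists (a *: w [::] + z0), z1; rewrite addrA; split=> //.
    by apply: lspan_cons => //; exists [::].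
  have tr : transitive (fun t u => N u < N t)%N.
    by move=> ? ? ? h1 h2; apply: ltn_trans h2 h1.
  have su : all (fun v => N v < N u)%N s by apply: order_path_min ds.
  move: sM => /= /andP[]; rewrite ltnS leq_eqVlt => /predU1P[uM|uM] sM.
    have -> : u = t by apply: N_inj; rewrite uM.
    exists z0, (a *: w s + z1); split=> //; last by rewrite preP pre_w addrCA.
    apply: lspan_cons => //; exists s; split=> //; last by rewrite -uM.
    exact: path_sorted ds.
  exists (a *: w (u :: s) + z0), z1; rewrite addrA; split=> //.
  apply: lspan_cons => //; exists (u :: s); split=> //=; rewrite uM /=.
  by apply: sub_all su => v vu; apply: ltn_trans vu uM.
have -> : y0 + pre t y1 = 1 *: pre t y1 + y0 by rewrite scale1r addrC.
move=> ev0; have dt z : lspan (dec_below M) z -> der t (ev z) = 0.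
  by rewrite -Nt; apply: der_below.
have y10 : y1 = 0.
  apply: IHM => //; rewrite -[ev y1](@der_eq t) ?dt //.
  have := derP t 1 (ev (pre t y1)) (ev y0).
  by rewrite -evP ev0 (linear_fun0 (derP t)) (dt y0) // addr0 scale1r ev_pre => <-.
move: ev0; rewrite y10 (linear_fun0 (preP t)) scaler0 add0r; exact: IHM.
Qed.

End Independence.

Lemma not_pairwiseP (X : eqType) (e : rel X) (s : seq X) : ~~ pairwise e s ->
  exists s1 t s2 u s3, s = s1 ++ t :: s2 ++ u :: s3 /\ ~~ e t u.
Proof.
elim: s => //= t s IHs; rewrite negb_and => /orP[/allPn[u us teu]|/IHs].
  by case/splitPr: us => s2 s3; exists [::], t, s2, u, s3.
by move=> [s1 [t' [s2 [u [s3 [-> teu]]]]]]; exists (t :: s1), t', s2, u, s3.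
Qed.

Lemma fixed_on_span (k : fieldType) (V U : lmodType k) (h : V -> U) (p : U -> U)
    (G : V -> Prop) (y : V) : linear h -> linear p ->
  (forall g, G g -> p (h g) = h g) -> lspan G y -> p (h y) = h y.
Proof.
move=> hP pP fixG; elim=> [|a g z Gg _ IH].
  by rewrite (linear_fun0 hP) (linear_fun0 pP).
by rewrite hP pP fixG // IH.
Qed.

(** * Skew derivations and the grading of the shuffle algebra *)

Section TwistedDerivation.
Variables (k : fieldType) (X : eqType) (cj : X -> X -> X) (V : lmodType k).
Variables (w : seq X -> V) (pre d S : X -> V -> V).
Hypothesis w_ind : forall P : V -> Prop,
  P 0 -> (forall a s x, P x -> P (a *: w s + x)) -> forall x, P x.
Hypothesis preP : forall t, linear (pre t).
Hypothesis pre_w : forall t s, pre t (w s) = w (t :: s).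
Hypothesis dP : forall r, linear (d r).
Hypothesis d_nil : forall r, d r (w [::]) = 0.
Hypothesis d_cons : forall r t s, d r (w (t :: s)) = if t == r then w s else 0.
Hypothesis SP : forall t, linear (S t).
Hypothesis S_nil : forall t, S t (w [::]) = w [:: t].
Hypothesis S_cons : forall t u s,
  S t (w (u :: s)) = w [:: t, u & s] - pre u (S (cj t u) (w s)).

Let linB (f : V -> V) x y : linear f -> f (x - y) = f x - f y.
Proof. by move=> fP; rewrite -[x - y]addrC -scaleN1r fP scaleN1r addrC. Qed.

Lemma derivation_pre r t y : d r (pre t y) = if t == r then y else 0.
Proof.
elim/w_ind: y => [|a s y IHy]; first by rewrite (linear_fun0 (preP t)) (linear_fun0 (dP r)) if_same.
by rewrite preP dP IHy pre_w d_cons; case: eqP; rewrite ?scaler0 ?addr0.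
Qed.

(** A skew Leibniz rule. Multiplying a word u s by t gives terms starting with t or with u;
    stripping u = r leaves t conjugated by r, and the sign comes from the shuffle. *)
Lemma derivation_mul r t x :
  d r (S t x) = (if t == r then x else 0) - S (cj t r) (d r x).
Proof.
elim/w_ind: x => [|a s x IHx]; first by
  rewrite (linear_fun0 (SP t)) (linear_fun0 (dP r)) (linear_fun0 (SP _)) if_same subr0.
have ws : d r (S t (w s)) = (if t == r then w s else 0) - S (cj t r) (d r (w s)).
  case: s => [|u s]; first by rewrite S_nil d_cons d_nil (linear_fun0 (SP _)) subr0.
  rewrite S_cons linB // !d_cons derivation_pre; congr (_ - _).
  by case: eqP => [->|_] //; rewrite (linear_fun0 (SP _)).
rewrite SP !dP IHx ws SP scalerBr opprD addrACA; congr (_ + _).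
by case: eqP; rewrite ?scaler0 ?addr0.
Qed.
End TwistedDerivation.

Section Shuffle.
Variables (k : fieldType) (W : finCoxeter) (c : W).
Local Notation T := (refl W).
Local Notation TX := (tensor k T).
Local Notation SA := (shuffle_alg k W).
Local Notation evsh := (thom (@sh_gen k W)).
Local Notation st := (star (k := k) (@rconj W)).
Implicit Types (t u r : T) (s : seq T) (x y z : TX).

Definition der_word r s : TX :=
  if s is t :: s' then if t == r then word s' else 0 else 0.
Definition der r : TX -> TX := lext (der_word r).

Lemma derP r a x y : der r (a *: x + y) = a *: der r x + der r y.
Proof. exact: lext_is_linear. Qed.

Lemma der_wordE r s : der r (word s) = der_word r s.
Proof. exact: lext_word. Qed.

Lemma starP t a x y : st (word [:: t]) (a *: x + y) =
  a *: st (word [:: t]) x + st (word [:: t]) y.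
Proof. by rewrite starDr -starZr. Qed.

Lemma star0 t : st (word [:: t]) 0 = 0.
Proof. by have := starZr (@rconj W) 0 (word [:: t]) (0 : TX); rewrite !scale0r. Qed.

Lemma star_wordE t s : st (word [:: t]) (word s) = star_word k (@rconj W) [:: t] s.
Proof. by rewrite /star !lext_word. Qed.

Lemma der_star r t x : der r (st (word [:: t]) x) =
  (if t == r then x else 0) - st (word [:: rconj t r]) (der r x).
Proof.
apply: (@derivation_mul k T (@rconj W) TX word (fun t => tcons t) der
  (fun t => st (word [:: t])) (@word_ind k T)).
- by move=> u a y z; apply: tcons_linear.
- exact: tcons_word.
- exact: derP.
- by move=> u; apply: der_wordE.
- by move=> u v s; apply: der_wordE.
- exact: starP.
- by move=> u; apply: star_wordE.
- move=> u v s; apply: etrans (star_wordE _ _) _; rewrite star_word1.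
  by congr (_ - tcons _ _); apply/esym/star_wordE.
Qed.

Definition homog j (w : W) (x : TX) := exists s, [/\ size s = j, rprod s = w & x = word s].

Lemma homog_tcons t j w x : lspan (homog j w) x ->
  lspan (homog j.+1 (val t * w)%g) (tcons t x).
Proof.
apply: span_map => _ [s [<- <- ->]]; apply: span_in; exists (t :: s).
by rewrite rprod_cons; split=> //; apply: tcons_word.
Qed.

(** Moving t past u turns it into t^u, and tu = ut^u, so the product in W is preserved: the twisted
    shuffle respects the grading by W and length. *)
Lemma homog_star_word t s :
  lspan (homog (size s).+1 (val t * rprod s)%g) (star_word k (@rconj W) [:: t] s).
Proof.
elim: s t => [|u s IHs] t.
  rewrite star_word_nilr; apply: span_in; exists [:: t].
  by rewrite rprod_cons.
rewrite star_word1; apply: spanD.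
  by apply: span_in; exists [:: t, u & s]; rewrite !rprod_cons.
rewrite -scaleN1r; apply: spanZ.
have -> : (val t * rprod (u :: s) = val u * (val (rconj t u) * rprod s))%g.
  by rewrite rprod_cons [LHS]mulgA [RHS]mulgA -(hurwitz_prod (t, u)).
exact/homog_tcons/IHs.
Qed.

Lemma homog_evsh s : lspan (homog (size s) (rprod s)) (evsh (word s) : TX).
Proof.
elim: s => [|t s IHs].
  by rewrite thom_word big_nil; apply: span_in; exists [::].
rewrite evsh_cons rprod_cons.
change (lspan (homog (size s).+1 (val t * rprod s)%g) (st (word [:: t]) (evsh (word s)))).
elim: IHs => [|a g z [s' [<- <- ->]] _ IH]; first by rewrite star0; apply: lspan0.
rewrite starP; apply: spanD => //; apply: spanZ; rewrite star_wordE.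
exact: homog_star_word.
Qed.

(** The projection onto the noncrossing degrees: it kills J_c and fixes the shuffle images of
    noncrossing words. *)
Definition nc_part : TX -> TX :=
  lext (fun s => if rprod s \in NC c (size s) then word s else 0).

Lemma nc_partP a x y : nc_part (a *: x + y) = a *: nc_part x + nc_part y.
Proof. exact: lext_is_linear. Qed.

Lemma nc_part0 : nc_part 0 = 0.
Proof. exact: linear0. Qed.

Lemma nc_part_homog j w x : lspan (homog j w) x ->
  nc_part x = if w \in NC c j then x else 0.
Proof.
elim=> [|a g z [s [<- <- ->]] _ IH]; first by rewrite nc_part0 if_same.
rewrite nc_partP IH /nc_part lext_word; case: ifP => // _.
by rewrite scaler0 addr0.
Qed.

Lemma nc_part_word s : rprod s \in NC c (size s) ->
  nc_part (evsh (word s)) = evsh (word s).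
Proof.
by move=> nc; have := nc_part_homog (homog_evsh s); rewrite nc.
Qed.

Lemma nc_part_Jc (z : nichols k W) : z \in Jc c -> nc_part (val z) = 0.
Proof.
have valP' a (x y : nichols k W) : (val (a *: x + y) : TX) = a *: (val x : TX) + (val y : TX).
  exact: (linearP (val : nichols k W -> SA)).
move=> /asboolP; elim=> [|a g y [w [j [bad gw]]] _ IH]; first exact: nc_part0.
rewrite valP' nc_partP IH addr0; suff -> : nc_part (val g) = 0 by rewrite scaler0.
elim: gw => [|b h z' [ts [sz pr ->]] _ IH']; first exact: nc_part0.
rewrite valP' nc_partP IH' addr0; suff -> : nc_part (val (\prod_(t <- ts) nich_gen k t)) = 0.
  by rewrite scaler0.
have -> : val (\prod_(t <- ts) nich_gen k t) = evsh (word ts).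
  by rewrite -val_evni thom_word.
by rewrite (nc_part_homog (homog_evsh ts)) sz pr (negPf bad).
Qed.

End Shuffle.

(** * The kernel *)

Section Kernel.
Variables (k : fieldType) (W : finCoxeter) (c : W).
Local Notation T := (refl W).
Local Notation TX := (tensor k T).
Local Notation SA := (shuffle_alg k W).
Local Notation Q := (quad_ideal (quad_perp (dual_braid_rel (k := k) c))).
Local Notation evsh := (thom (@sh_gen k W)).
Local Notation evni := (thom (@nich_gen k W)).
Implicit Types (t u r : T) (s : seq T) (x y z : TX).

Variables (N : T -> nat) (e : rel T).
Hypothesis N_inj : injective N.
Hypothesis asc_uniq : forall t u t' u', (val t * val u)%g \in NC c 2 ->
  (val t * val u = val t' * val u')%g -> (N t < N u)%N -> (N t' < N u')%N -> t = t'.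
Hypothesis NC_e : forall t u, (val t * val u)%g \in NC c 2 -> e t u.
Hypothesis e_pencil : forall t u t' u' r, (val t * val u)%g \in NC c 2 ->
  (val t * val u = val t' * val u')%g -> ~~ e t r -> e u r -> u' != u -> ~~ e u' r.
Hypothesis e_NC : forall s, pairwise e s -> rprod s \in NC c (size s).

Let q0 : (0 : TX) \in Q. Proof. exact: rpred0. Qed.
Let qD x y : x \in Q -> y \in Q -> x + y \in Q. Proof. exact: rpredD. Qed.
Let qZ a x : x \in Q -> a *: x \in Q. Proof. exact: Q_scale. Qed.
Local Notation redq := (red (V := TX) (fun x => x \in Q)).

Lemma word_sandwich s1 s s2 : word (s1 ++ s ++ s2) = word s1 * word s * word s2 :> TX.
Proof. by rewrite !wordM catA. Qed.

Lemma word_in_sandwich s1 s s2 : (word s : TX) \in Q -> (word (s1 ++ s ++ s2) : TX) \in Q.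
Proof. by move=> Qs; rewrite word_sandwich; apply: tsidealMl; apply: idealMr. Qed.

Lemma sum_product_sandwich s1 s2 (w : W) :
  \sum_(p | (val p.1 * val p.2 == w)%g) word (s1 ++ [:: p.1; p.2] ++ s2) \in Q.
Proof.
have -> : \sum_(p | (val p.1 * val p.2 == w)%g) word (s1 ++ [:: p.1; p.2] ++ s2) =
    word s1 * (\sum_(p : T * T | (val p.1 * val p.2 == w)%g) word [:: p.1; p.2]) * word s2 :> TX.
  rewrite (@sum_sandwich TX); apply: eq_bigr => p _; exact: word_sandwich.
by apply: tsidealMl; apply: idealMr; apply: sum_product_in.
Qed.

(* Rewriting x_t x_r by the other factorizations of t r moves a letter not   *)
(* e-orthogonal to u one step to the right, until it meets u.                *)
Lemma word_not_e s1 t s2 u : ~~ e t u -> word (s1 ++ t :: s2 ++ [:: u]) \in Q.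
Proof.
elim: s2 s1 t => [|r s2 IHs] s1 t etu.
  rewrite -[_ :: _]/([:: t; u] ++ [::]); apply: word_in_sandwich.
  by apply: word_bad; apply: contra etu; apply: NC_e.
have [eru|eru] := boolP (e r u); last first.
  by have := IHs (rcons s1 t) r eru; rewrite cat_rcons.
have [nc|bad] := boolP ((val t * val r)%g \in NC c 2); last first.
  by apply: (@word_in_sandwich s1 [:: t; r] (s2 ++ [:: u])); apply: word_bad.
apply: (@red_false _ TX (fun x => x \in Q)).
pose F (p : T * T) : TX := word (s1 ++ [:: p.1; p.2] ++ (s2 ++ [:: u])).
apply: (@red_pick _ TX (fun x => x \in Q) q0 qD qZ (fun=> False) _
  (fun p => (val p.1 * val p.2 == val t * val r)%g) F (t, r)) => //.
  exact: sum_product_sandwich.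
move=> [t' r'] /= /eqP E ne; apply: red_Q => //.
have r'r : r' != r.
  apply: contra ne => /eqP r'r; move: E; rewrite r'r => /mulIg/val_inj ->.
  by rewrite eqxx.
have := IHs (rcons s1 t') r' (e_pencil nc (esym E) etu eru r'r).
by rewrite cat_rcons.
Qed.

Lemma word_not_NC s : rprod s \notin NC c (size s) -> word s \in Q.
Proof.
move=> bad; have /not_pairwiseP[s1 [t [s2 [u [s3 [-> etu]]]]]] : ~~ pairwise e s.
  by apply: contra bad; apply: e_NC.
have := @word_in_sandwich [::] _ s3 (word_not_e s1 s2 etu).
by rewrite /= -catA /= -catA.
Qed.

(** Take a factorization (r,r') with r of least rank. Its Hurwitz move starts with r', so (r,r') is
    an ascent, and uniqueness of ascents gives r = t. *)
Lemma ascent_min t u t' u' : (val t * val u)%g \in NC c 2 -> (N t < N u)%N ->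
  (val t' * val u' = val t * val u)%g -> (t', u') != (t, u) -> (N t < N t')%N.
Proof.
move=> nc tu E ne; pose P (p : T * T) := (val p.1 * val p.2 == val t * val u)%g.
have P0 : P (t', u') by rewrite /P /= E.
case: (arg_minnP (fun p : T * T => N p.1) P0) => -[r r'] /eqP /= rE rmin.
have rr' : r != r'.
  apply: contraTneq nc => rr'; rewrite -rE rr' refl_invol.
  by rewrite inE rlen1 andbF.
have le : (N r <= N r')%N.
  by apply: (rmin (r', rconj r r')); rewrite /P (hurwitz_prod (r, r')) /= rE.
have lt : (N r < N r')%N.
  by rewrite ltn_neqAle le andbT; apply: contra rr' => /eqP/N_inj ->.
have tr : t = r by apply: asc_uniq nc (esym rE) tu lt.
rewrite ltn_neqAle tr (rmin (t', u') P0) andbT -tr; apply: contra ne => /eqP/N_inj tt'.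
by move: E; rewrite -tt' => /mulgI/val_inj ->.
Qed.

Definition dec_word j x := exists s, [/\ size s = j, decreasing N s & x = word s].

(** Induction on the length makes the tail decreasing. If the first two letters still ascend, the
    product relation trades them for pairs with a first letter of larger rank ([ascent_min]), and
    ranks are bounded by [B]. *)
Lemma reduce_word j s : size s = j -> redq (dec_word j) (word s).
Proof.
elim: j s => [|j IHj] s.
  by move=> /size0nil ->; apply: red_in => //; exists [::].
case: s => // t s [szs]; pose B := \max_(r : T) N r.
have leB r : (N r <= B)%N by apply: leq_bigmax.
have [m] := ubnP (B - N t)%N; elim: m t s szs => // m IHm t s szs lem.
rewrite -tcons_word.
apply: (@red_map _ TX (fun x => x \in Q) q0 qD qZ (tcons t) (dec_word j)).
- by move=> y Qy; apply: idealMr.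
- move=> _ [s1 [sz1 d1 ->]].
  suff : redq (dec_word j.+1) (word (t :: s1)) by rewrite -tcons_word.
  case: s1 sz1 d1 => [|u s1] sz1 d1.
    by apply: red_in => //; exists [:: t]; rewrite -sz1.
  have [bad|nc] := boolP ((val t * val u)%g \notin NC c 2).
    apply: red_Q => //; apply: (@word_in_sandwich [::] [:: t; u] s1).
    exact: word_bad.
  rewrite negbK in nc.
  case: (ltngtP (N u) (N t)) => [ut|tu|/N_inj ut].
  + by apply: red_in => //; exists [:: t, u & s1]; split; [rewrite -sz1 | apply/andP |].
  + pose F (p : T * T) : TX := word ([::] ++ [:: p.1; p.2] ++ s1).
    apply: (@red_pick _ TX (fun x => x \in Q) q0 qD qZ _ _
      (fun p => (val p.1 * val p.2 == val t * val u)%g) F (t, u)) => //.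
      exact: sum_product_sandwich.
    move=> [t' u'] /eqP E ne; apply: IHm; first by rewrite -sz1.
    have /= lt := ascent_min nc tu E ne; rewrite -ltnS.
    by apply: leq_trans lem; rewrite ltnS ltn_sub2l // (leq_trans lt).
  + by move: nc; rewrite ut refl_invol inE rlen1 andbF.
- exact: IHj.
Qed.

Definition dec_NC_word x :=
  exists s, [/\ decreasing N s, rprod s \in NC c (size s) & x = word s].

Lemma reduce x : redq dec_NC_word x.
Proof.
elim/word_ind: x => [|a s x IHx]; first exact: red_Q.
apply: redD => //; apply: redZ => //.
apply: (@red_trans _ TX (fun x => x \in Q) q0 qD qZ _ _ _ _ (reduce_word (erefl (size s)))).
move=> _ [s' [_ d ->]]; have [nc|bad] := boolP (rprod s' \in NC c (size s')).
  by apply: red_in => //; exists s'.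
by apply: red_Q => //; apply: word_not_NC.
Qed.

(** Modulo Q, x is a combination y of decreasing noncrossing words. Its shuffle image is fixed by
    [nc_part], yet killed by it as an element of J_c, so it is zero, and independence gives y =
    0. *)
Lemma evni_ker x : evni x \in Jc c -> x \in Q.
Proof.
move=> Jx; have [y Dy Qxy] := reduce x.
suff y0 : y = 0 by move: Qxy; rewrite y0 subr0.
have Jy : evni y \in Jc c.
  have -> : y = x - (x - y) by rewrite opprB addrC subrK.
  by rewrite raddfB rpredB //; apply: evni_Q.
have ev0 : evsh y = 0.
  apply: etrans (nc_part_Jc Jy); rewrite val_evni; apply: esym.
  apply: (@fixed_on_span k TX SA evsh (@nc_part k W c) dec_NC_word y _ _ _ Dy).
  - exact: thomP.
  - exact: nc_partP.
  - by move=> _ [s [_ nc ->]]; apply: nc_part_word.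
pose B := (\max_(r : T) N r).+1.
have leB r : (N r < B)%N by rewrite ltnS; apply: leq_bigmax.
apply: (@decreasing_free k T N TX SA word (fun t => tcons t) evsh (@der k W)
  (fun t z => sh_gen k t * z) N_inj _ _ _ _ _ _ _ _ _ B y) ev0.
- by move=> t a x' y'; apply: tcons_linear.
- exact: tcons_word.
- exact: thomP.
- exact: derP.
- by move=> t z; rewrite /tcons rmorphM /= thom_word big_seq1.
- by move=> t; rewrite thom_word big_nil; apply: der_wordE.
- move=> t u z ut dz; apply: etrans (der_star _ _ _) _.
  by rewrite (negPf ut) dz star0 subr0.
- move=> t z dz; apply: etrans (der_star _ _ _) _.
  by rewrite eqxx dz star0 subr0.
- move=> a; rewrite linearZ /= thom_word big_nil; exact.
- elim: Dy {Qxy Jy} => [|a g z [s [ds _ ->]] _ IH]; first exact: lspan0.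
  apply: lspan_cons => //; exists s; split=> //.
  by apply/allP => r _; apply: leB.
Qed.

End Kernel.

Theorem theorem7p12 (k : fieldType) (W : finCoxeter) (c : W)
    (hc : standard_coxeter_elt c) :
  exists Psi : {lrmorphism Palg k c -> Palg' k c},
    bijective Psi /\
    forall ts : seq (refl W),
      Psi (\prod_(t <- ts) Pgen k c t) = Pproj c (\prod_(t <- ts) nich_gen k t).
Proof.
have [N [e [N_inj asc_uniq NC_e e_pencil e_NC]]] := NC_geometry hc.
exists (Psi (k := k) (c := c)); split; last exact: Psi_word.
have inj := Psi_inj (evni_ker N_inj asc_uniq NC_e e_pencil e_NC).
have [g gK] := choice (@Psi_surj k W c).
by exists g => // x; apply: inj; rewrite gK.
Qed.
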